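(* Let $c>0$, let $\nu,\tilde\nu$ be probability measures on $\mathbb R_+$ different from $\boldsymbol d_0$, and let $\delta,\tilde\delta,m,\mu,\rho,\tilde\rho$ be as defined below. For every $x\in\mathbb R_*=\mathbb R\setminus\{0\}$, the limit $m(x):=\lim_{z\in\mathbb C_+\to x}m(z)$ exists; the function $x\mapsto\Im m(x)$ is continuous on $\mathbb R_*$, and $\mu$ has on $\mathbb R_*$ a continuous density $f(x)=\pi^{-1}\Im m(x)$. Similarly, for every $x\in\mathbb R_*$ the limits $\delta(x):=\lim_{z\in\mathbb C_+\to x}\delta(z)$ and $\tilde\delta(x):=\lim_{z\in\mathbb C_+\to x}\tilde\delta(z)$ exist, the functions $\Im\delta(x)$ and $\Im\tilde\delta(x)$ are continuous on $\mathbb R_*$, and $\rho$ and $\tilde\rho$ have continuous densities on $\mathbb R_*$. Finally, $$\operatorname{supp}(\rho)\cap\mathbb R_*=\operatorname{supp}(\tilde\rho)\cap\mathbb R_*=\operatorname{supp}(\mu)\cap\mathbb R_*.$$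
   Context: $\mathbb C_+=\{z:\Im z>0\}$, $\boldsymbol d_0$ is the Dirac mass at $0$. For $z\in\mathbb C_+$, $(\delta(z),\tilde\delta(z))$ is the unique solution in $\mathbb C_+^2$ of $\delta = c\int \frac{t}{-z(1+\tilde\delta t)}\nu(dt)$, $\tilde\delta=\int\frac{t}{-z(1+\delta t)}\tilde\nu(dt)$. The function $m(z)=\int\frac{1}{-z(1+\tilde\delta(z)t)}\nu(dt)$ is the Stieltjes transform $\int\frac{1}{t-z}\mu(dt)$ of a probability measure $\mu$ on $\mathbb R_+$. Moreover $\delta(z)=\int_0^\infty\frac{\rho(dt)}{t-z}$ and $\tilde\delta(z)=\int_0^\infty\frac{\tilde\rho(dt)}{t-z}$ for positive Radon measures $\rho,\tilde\rho$ on $\mathbb R_+$ with $0<\int(1+t)^{-1}\rho(dt)<\infty$, $0<\int(1+t)^{-1}\tilde\rho(dt)<\infty$. The limits $z\in\mathbb C_+\to x$ are limits as $z$ tends to $x$ within $\mathbb C_+$ (the paper calls them nontangential limits). *)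

(* Defs.v *)
From mathcomp Require Import all_boot all_order all_algebra.
From mathcomp Require Import complex.
From mathcomp Require Import all_classical all_reals all_analysis.
Import Order.TTheory GRing.Theory Num.Theory.
Import numFieldNormedType.Exports.
Local Open Scope ring_scope.
Local Open Scope classical_set_scope.
Local Open Scope complex_scope.

Definition Rplus (R : realType) : set R := [set t | 0 <= t].
Definition Rstar (R : realType) : set R := [set x | x != 0].

(* A measure on R_+ is modelled as a Borel measure on R that vanishes on ]-oo,0[. *)
Definition supported_Rplus {R : realType} (mu : {measure set R -> \bar R}) : Prop :=
  mu [set t | t < 0] = 0%E.

Definition cint {R : realType} (mu : {measure set R -> \bar R}) (f : R -> R[i]) : R[i] :=
  Complex (Rintegral mu (Rplus R) (fun t => complex.Re (f t)))
          (Rintegral mu (Rplus R) (fun t => complex.Im (f t))).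

Definition cabs {R : realType} (z : R[i]) : R :=
  Num.sqrt (complex.Re z ^+ 2 + complex.Im z ^+ 2).

Definition Cplus {R : realType} (z : R[i]) : Prop := 0 < complex.Im z.

Definition lim_Cplus {R : realType} (f : R[i] -> R[i]) (x : R) (L : R[i]) : Prop :=
  forall e : R, 0 < e -> exists2 d : R, 0 < d &
    forall z : R[i], Cplus z -> cabs (z - x%:C) < d -> cabs (f z - L) < e.

Definition stieltjes {R : realType} (mu : {measure set R -> \bar R}) (z : R[i]) : R[i] :=
  cint mu (fun t => (t%:C - z)^-1).

Definition m_transform {R : realType} (nu : {measure set R -> \bar R}) (dt : R[i] -> R[i])
  (z : R[i]) : R[i] :=
  cint nu (fun t => (- z * (1 + dt z * t%:C))^-1).

Definition msupp {R : realType} (mu : {measure set R -> \bar R}) : set R :=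
  [set x | forall e : R, 0 < e -> (0%E < mu `]x - e, x + e[%classic)%O].

Definition density_on_Rstar {R : realType} (mu : {measure set R -> \bar R}) (f : R -> R) : Prop :=
  forall A : set R, measurable A -> A `<=` Rstar R ->
    mu A = (\int[lebesgue_measure]_(x in A) (f x)%:E)%E.

Definition boundary_density {R : realType} (F : R[i] -> R[i])
  (mu : {measure set R -> \bar R}) : Prop :=
  exists Fb : R -> R[i],
    (forall x : R, x != 0 -> lim_Cplus F x (Fb x)) /\
    (forall x : R, x != 0 -> {for x, continuous (fun y : R => complex.Im (Fb y))}) /\
    density_on_Rstar mu (fun x => complex.Im (Fb x) / pi).

(* Main.v *)
(** Write [u(t) = t / (1 + deltat t)] and [gam = c \int |u|^2 dnu], and let [gamt] be the same
quantity for [delta] and [nut]. Taking imaginary parts in the system gives [gam * gamt <= |z|^2].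
By Cauchy-Schwarz this bounds [delta t / (1 + delta t)] and [deltat t / (1 + deltat t)] in [L^2],
so that a blow-up of [delta] near [x != 0] would give two different limits for
[z * delta * deltat].

If [(D, Dt)] and [(D', Dt')] are two cluster values at the same [x != 0], subtracting the
equations shows that [x^2] is at most a product of two Cauchy-Schwarz pairings, each dominated
by the corresponding geometric mean of [gam]'s, whose product is at most [x^2]. Equality in
Cauchy-Schwarz forces [D] to be the conjugate of [D']; both lie in the closed upper half-plane,
hence [D = D']. The argument is run along an ultrafilter, on the scalars only, so that no
limit is taken under an integral sign.

The limit of [m] follows from [m = - 1 / z - delta * deltat / c]. The densities come from
Stieltjes inversion (Tonelli and the arctangent), and the supports agree because the boundary
imaginary parts of [m], [delta] and [deltat] bound each other up to positive factors. *)
From HB Require Import structures.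
Require Import Defs.
From mathcomp Require Import all_boot all_order all_algebra.
From mathcomp Require Import complex.
From mathcomp Require Import all_classical all_reals all_analysis.
From mathcomp Require Import measurable_realfun.
From mathcomp Require Import ring lra.
Set Implicit Arguments.
Unset Strict Implicit.
Unset Printing Implicit Defensive.
Import Order.TTheory GRing.Theory Num.Theory.
Import numFieldNormedType.Exports.
Local Open Scope ring_scope.
Local Open Scope classical_set_scope.
Local Open Scope complex_scope.

(** * Real and imaginary parts, and the squared modulus *)

Section ComplexParts.
Context {R : realType}.
Implicit Types (z w : R[i]) (a : R).
Local Notation Re := complex.Re.
Local Notation Im := complex.Im.

(** Every analytic fact is therefore proved inside the open half-plane, as an equation or a
    non-strict inequality between finitely many scalars, with constants ([kap1], [kap2], [kap4])
    that depend only on a bound for |w|^2. Such relations survive any limit.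

    For the same reason the case of equality in Cauchy-Schwarz is not treated as proportionality of
    two functions. The defect [gam w * gam w' - nrm2 (cov w w')] is made to control two scalars: the
    integral of the residual [vker], which yields that one boundary value is a multiple of the
    conjugate of the other, and the constant coefficient of the numerator of [vker], which shows
    that the multiple is 1.

    The squared modulus is preferred to the modulus because it is polynomial in the real and
    imaginary parts. *)

Definition nrm2 z : R := Re z ^+ 2 + Im z ^+ 2.

Lemma ReD z w : Re (z + w) = Re z + Re w. Proof. by case: z w => ? ? []. Qed.
Lemma ImD z w : Im (z + w) = Im z + Im w. Proof. by case: z w => ? ? []. Qed.
Lemma ReN z : Re (- z) = - Re z. Proof. by case: z. Qed.
Lemma ImN z : Im (- z) = - Im z. Proof. by case: z. Qed.
Lemma ReM z w : Re (z * w) = Re z * Re w - Im z * Im w.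
Proof. by case: z w => ? ? []. Qed.
Lemma ImM z w : Im (z * w) = Re z * Im w + Im z * Re w.
Proof. by case: z w => ? ? []. Qed.
Lemma ReV z : Re z^-1 = Re z / nrm2 z. Proof. by case: z. Qed.
Lemma ImV z : Im z^-1 = - (Im z / nrm2 z). Proof. by case: z. Qed.
Lemma ReC a : Re a%:C = a. Proof. by []. Qed.
Lemma ImC a : Im a%:C = 0. Proof. by []. Qed.
Lemma Re1 : Re (1 : R[i]) = 1. Proof. by []. Qed.
Lemma Im1 : Im (1 : R[i]) = 0. Proof. by []. Qed.
Lemma ReJ z : Re (conjc z) = Re z. Proof. by case: z. Qed.
Lemma ImJ z : Im (conjc z) = - Im z. Proof. by case: z. Qed.
Definition partsE := (ReD, ImD, ReN, ImN, ReM, ImM, ReV, ImV, ReJ, ImJ, ReC, ImC, Re1, Im1).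

Lemma complexP z w : Re z = Re w -> Im z = Im w -> z = w.
Proof. by case: z w => a b [c d] /= -> ->. Qed.

Lemma conjcM z w : conjc (z * w) = conjc z * conjc w.
Proof. by apply: complexP; rewrite !partsE; ring. Qed.
Lemma conjcD z w : conjc (z + w) = conjc z + conjc w.
Proof. by apply: complexP; rewrite !partsE; ring. Qed.
Lemma conjcC a : conjc a%:C = a%:C.
Proof. by apply: complexP; rewrite !partsE// oppr0. Qed.

Lemma nrm2_ge0 z : 0 <= nrm2 z. Proof. by rewrite addr_ge0// sqr_ge0. Qed.
Lemma nrm2M z w : nrm2 (z * w) = nrm2 z * nrm2 w.
Proof. by rewrite /nrm2 !partsE; ring. Qed.
Lemma nrm2N z : nrm2 (- z) = nrm2 z.
Proof. by rewrite /nrm2 !partsE; ring. Qed.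
Lemma nrm2J z : nrm2 (conjc z) = nrm2 z.
Proof. by rewrite /nrm2 !partsE; ring. Qed.
Lemma nrm2C a : nrm2 a%:C = a ^+ 2.
Proof. by rewrite /nrm2 !partsE; ring. Qed.
Lemma nrm2_eq0 z : (nrm2 z == 0) = (z == 0).
Proof.
by rewrite /nrm2 paddr_eq0 ?sqr_ge0// !sqrf_eq0 eq_complex.
Qed.
Lemma nrm2_gt0 z : (0 < nrm2 z) = (z != 0).
Proof. by rewrite lt_neqAle nrm2_ge0 andbT eq_sym nrm2_eq0. Qed.
Lemma nrm2V z : nrm2 z^-1 = (nrm2 z)^-1.
Proof.
have [->|z0] := eqVneq z 0; first by rewrite invr0 /nrm2 /= expr0n /= addr0 invr0.
apply: (@mulfI _ (nrm2 z)); first by rewrite nrm2_eq0.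
by rewrite -nrm2M !divff ?nrm2_eq0// nrm2C expr1n.
Qed.
Lemma nrm2D_le z w : nrm2 (z + w) <= 2 * nrm2 z + 2 * nrm2 w.
Proof.
rewrite -subr_ge0.
rewrite (_ : _ - _ = nrm2 (z - w)) ?nrm2_ge0//.
by rewrite /nrm2 !partsE; ring.
Qed.

Lemma Cplus_neq0 z : Cplus z -> z != 0.
Proof. by rewrite /Cplus eq_complex => /gt_eqF h; rewrite negb_and (_ : (Im z == Im 0) = false) ?orbT. Qed.

Lemma cabs_ge0 z : 0 <= cabs z. Proof. exact: sqrtr_ge0. Qed.
Lemma sqr_cabs z : cabs z ^+ 2 = nrm2 z.
Proof. by rewrite sqr_sqrtr// nrm2_ge0. Qed.
Lemma cabsE z : (cabs z)%:C = `|z|. Proof. by rewrite normc_def. Qed.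
Lemma cabsD z w : cabs (z + w) <= cabs z + cabs w.
Proof. by rewrite -lecR rmorphD /= !cabsE ler_normD. Qed.
Lemma cabsN z : cabs (- z) = cabs z.
Proof. by apply/complexI; rewrite !cabsE normrN. Qed.
Lemma cabs_dist z w : cabs (z - w) = cabs (w - z).
Proof. by rewrite -cabsN opprB. Qed.
Lemma Re_le_cabs z : `|Re z| <= cabs z.
Proof. by rewrite -sqrtr_sqr ler_wsqrtr// lerDl sqr_ge0. Qed.
Lemma Im_le_cabs z : `|Im z| <= cabs z.
Proof. by rewrite -sqrtr_sqr ler_wsqrtr// lerDr sqr_ge0. Qed.
Lemma cabs_le_parts z : cabs z <= `|Re z| + `|Im z|.
Proof.
rewrite -(@ler_pXn2r _ 2)// ?nnegrE ?cabs_ge0 ?addr_ge0//.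
rewrite sqr_cabs sqrrD !real_normK ?num_real// /nrm2.
by rewrite -addrA lerD2l lerDr mulrn_wge0// mulr_ge0.
Qed.
Lemma cabs_le_nrm2 z a : 0 <= a -> (cabs z <= a) = (nrm2 z <= a ^+ 2).
Proof. by move=> a0; rewrite -sqr_cabs ler_pXn2r// nnegrE cabs_ge0. Qed.
End ComplexParts.

(** * Bounded measurable functions and the two kernels *)

Section BoundedMeasurable.
Context {R : realType}.
Local Notation Re := complex.Re.
Local Notation Im := complex.Im.
Implicit Types (f g : R -> R) (F G : R -> R[i]).

(** These functions form an algebra, integrable for every probability measure, so that integrals can
    be split and rescaled without separate integrability arguments. *)
Definition bmeas f := measurable_fun setT f /\ exists M, forall t, `|f t| <= M.

Lemma bmeas_cst (a : R) : bmeas (fun=> a).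
Proof. by split; [exact: measurable_cst|exists `|a|]. Qed.

Lemma bmeasD f g : bmeas f -> bmeas g -> bmeas (fun t => f t + g t).
Proof.
move=> [mf [M fM]] [mg [N gN]]; split; first exact: measurable_funD.
by exists (M + N) => t; rewrite (le_trans (ler_normD _ _))// lerD.
Qed.

Lemma bmeasM f g : bmeas f -> bmeas g -> bmeas (fun t => f t * g t).
Proof.
move=> [mf [M fM]] [mg [N gN]]; split; first exact: measurable_funM.
by exists (M * N) => t; rewrite normrM ler_pM.
Qed.

Lemma bmeasN f : bmeas f -> bmeas (fun t => - f t).
Proof.
move=> /(bmeasM (bmeas_cst (-1))); congr bmeas.
by apply/funext => t; rewrite mulN1r.
Qed.

Lemma bmeasB f g : bmeas f -> bmeas g -> bmeas (fun t => f t - g t).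
Proof. by move=> bf /bmeasN; exact: bmeasD. Qed.

Lemma bmeasX f n : bmeas f -> bmeas (fun t => f t ^+ n).
Proof.
move=> bf; elim: n => [|n ih]; first exact: bmeas_cst.
by under eq_fun do rewrite exprS; exact: bmeasM.
Qed.

Lemma bmeas_norm f : bmeas f -> bmeas (fun t => `|f t|).
Proof.
move=> [mf [M fM]]; split; first exact: measurableT_comp.
by exists M => t; rewrite normr_id.
Qed.

Definition cbmeas F := bmeas (fun t => Re (F t)) /\ bmeas (fun t => Im (F t)).

Lemma cbmeas_cst (a : R[i]) : cbmeas (fun=> a).
Proof. by split; exact: bmeas_cst. Qed.
Lemma cbmeasD F G : cbmeas F -> cbmeas G -> cbmeas (fun t => F t + G t).
Proof.
move=> [? ?] [? ?]; split; under eq_fun do rewrite partsE; exact: bmeasD.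
Qed.
Lemma cbmeasN F : cbmeas F -> cbmeas (fun t => - F t).
Proof.
move=> [? ?]; split; under eq_fun do rewrite partsE; exact: bmeasN.
Qed.
Lemma cbmeasM F G : cbmeas F -> cbmeas G -> cbmeas (fun t => F t * G t).
Proof.
move=> [? ?] [? ?]; split; under eq_fun do rewrite partsE.
- by apply: bmeasB; exact: bmeasM.
- by apply: bmeasD; exact: bmeasM.
Qed.
Lemma cbmeasJ F : cbmeas F -> cbmeas (fun t => conjc (F t)).
Proof.
move=> [? ?]; split; under eq_fun do rewrite partsE; [by []|exact: bmeasN].
Qed.
Lemma bmeas_nrm2 F : cbmeas F -> bmeas (fun t => nrm2 (F t)).
Proof. by move=> [? ?]; apply: bmeasD; exact: bmeasX. Qed.

(** Up to the factor [(- z)^-1], [uker] is the integrand of the system and [rker] that of [m]. For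
    [w] in the upper half-plane both are bounded on the whole line, negative [t] included. *)
Definition uker (w : R[i]) (t : R) : R[i] := t%:C / (1 + w * t%:C).
Definition rker (w : R[i]) (t : R) : R[i] := (1 + w * t%:C)^-1.

Lemma nrm2_rker_den (w : R[i]) (t : R) :
  nrm2 (1 + w * t%:C) = (1 + Re w * t) ^+ 2 + (Im w * t) ^+ 2.
Proof. by rewrite /nrm2 !partsE; ring. Qed.

Lemma rker_den_neq0 (w : R[i]) (t : R) : Cplus w -> 1 + w * t%:C != 0.
Proof.
move=> w0; rewrite -nrm2_eq0 nrm2_rker_den paddr_eq0 ?sqr_ge0// !sqrf_eq0 negb_and.
have [->|t0] := eqVneq t 0; first by rewrite !mulr0 addr0 oner_eq0.
by rewrite mulf_eq0 (gt_eqF w0) (negbTE t0) orbT.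
Qed.

(** The left side is the squared distance from 0 to the line of all [1 + w t]; multiplied by |w|^2,
    the gap is the square of [Re w + |w|^2 t]. *)
Lemma nrm2_rker_den_ge (w : R[i]) (t : R) : Cplus w ->
  Im w ^+ 2 / nrm2 w <= nrm2 (1 + w * t%:C).
Proof.
move=> w0; have n0 : 0 < nrm2 w by rewrite nrm2_gt0 Cplus_neq0.
rewrite ler_pdivrMr// nrm2_rker_den -subr_ge0 /nrm2.
set a := Re w; set b := Im w.
rewrite (_ : _ - _ = (a + (a ^+ 2 + b ^+ 2) * t) ^+ 2); last by ring.
exact: sqr_ge0.
Qed.

Lemma measurable_inv_pos f : (forall t, 0 < f t) -> continuous f ->
  measurable_fun setT (fun t => (f t)^-1).
Proof.
move=> f0 cf; apply: continuous_measurable_fun => t.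
by apply: cvgV; [rewrite gt_eqF|exact: cf].
Qed.

Lemma continuous_nrm2_den (w : R[i]) : continuous (fun t : R => nrm2 (1 + w * t%:C)).
Proof.
move=> t; under eq_fun do rewrite nrm2_rker_den.
apply: cvgD; rewrite /=.
  under eq_fun do rewrite expr2; rewrite expr2.
  by apply: cvgM; (apply: cvgD; [exact: cvg_cst|apply: cvgM; [exact: cvg_cst|exact: cvg_id]]).
under eq_fun do rewrite expr2; rewrite expr2.
by apply: cvgM; (apply: cvgM; [exact: cvg_cst|exact: cvg_id]).
Qed.

Lemma measurable_den_inv (w : R[i]) : Cplus w ->
  measurable_fun setT (fun t : R => (nrm2 (1 + w * t%:C))^-1).
Proof.
move=> w0; apply: measurable_inv_pos; last exact: continuous_nrm2_den.
by move=> t; rewrite nrm2_gt0 rker_den_neq0.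
Qed.

Lemma cbmeas_parts F M : measurable_fun setT (fun t => Re (F t)) ->
  measurable_fun setT (fun t => Im (F t)) -> (forall t, nrm2 (F t) <= M ^+ 2) -> 0 <= M ->
  cbmeas F.
Proof.
move=> mR mI FM M0; split; split=> //; exists M => t.
- by rewrite (le_trans (Re_le_cabs _))// cabs_le_nrm2.
- by rewrite (le_trans (Im_le_cabs _))// cabs_le_nrm2.
Qed.

Lemma measurable_affine (a b : R) : measurable_fun setT (fun t : R => a + b * t).
Proof.
by apply: measurable_funD => //; apply: measurable_funM.
Qed.

Lemma cbmeas_rker (w : R[i]) : Cplus w -> cbmeas (rker w).
Proof.
move=> w0; have n0 : 0 < nrm2 w by rewrite nrm2_gt0 Cplus_neq0.
have md := measurable_den_inv w0.
apply: (@cbmeas_parts _ (Num.sqrt (Im w ^+ 2 / nrm2 w))^-1).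
- rewrite /rker; under eq_fun do rewrite ReV !partsE mulr0 subr0.
  by apply: measurable_funM => //; exact: measurable_affine.
- rewrite /rker; under eq_fun do rewrite ImV !partsE mulr0 !add0r.
  apply: measurableT_comp => //.
  by apply: measurable_funM => //; exact: measurable_funM.
- move=> t; rewrite nrm2V exprVn sqr_sqrtr; last by rewrite divr_ge0 ?sqr_ge0// ltW.
  rewrite lef_pV2 ?posrE ?nrm2_gt0 ?rker_den_neq0 ?nrm2_rker_den_ge//.
  by rewrite divr_gt0// exprn_gt0.
- by rewrite invr_ge0 sqrtr_ge0.
Qed.

Lemma ukerE (w : R[i]) (t : R) : uker w t = t%:C * rker w t. Proof. by []. Qed.

(** Divide [w t = (1 + w t) - 1] by [1 + w t]. This transfers boundedness from [rker] to [uker], and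
    later links [m] to the system. *)
Lemma uker_rker (w : R[i]) (t : R) : Cplus w -> w * uker w t = 1 - rker w t.
Proof.
move=> w0; rewrite /uker /rker; field; exact: rker_den_neq0.
Qed.

Lemma cbmeas_uker (w : R[i]) : Cplus w -> cbmeas (uker w).
Proof.
move=> w0; rewrite (_ : uker w = fun t => w^-1 * (1 - rker w t)).
  apply: cbmeasM; first exact: cbmeas_cst.
  by apply: cbmeasD; [exact: cbmeas_cst|apply/cbmeasN/cbmeas_rker].
by apply/funext => t; rewrite -uker_rker// mulKf// Cplus_neq0.
Qed.

End BoundedMeasurable.

(** * Integration over the half-line against a probability measure *)

Section Expectation.
Context {R : realType} (nu : probability R R).
Hypothesis nu_Rplus : supported_Rplus nu.
Local Notation Re := complex.Re.
Local Notation Im := complex.Im.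
Implicit Types (f g : R -> R) (F G : R -> R[i]).

Definition Ex f : R := Rintegral nu (Rplus R) f.

Lemma RplusE : Rplus R = `[0, +oo[%classic.
Proof. by apply/seteqP; split=> t /=; rewrite in_itv/= andbT. Qed.

Lemma measurable_Rplus : measurable (Rplus R).
Proof. by rewrite RplusE. Qed.
Hint Resolve measurable_Rplus : core.

Lemma measurable_pos : measurable [set t : R | 0 < t].
Proof.
rewrite (_ : [set t : R | 0 < t] = `]0, +oo[%classic)//.
by apply/seteqP; split=> t /=; rewrite in_itv/= andbT.
Qed.

Lemma bmeas_integrable f : bmeas f -> nu.-integrable (Rplus R) (EFin \o f).
Proof.
move=> [mf [M fM]]; apply: measurable_bounded_integrable => //.
- by rewrite (le_lt_trans (probability_le1 _ _))// ltry.
- exact: measurable_funTS.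
- exists M; split; first by rewrite num_real.
  by move=> N MN t _ /=; rewrite (le_trans (fM t))// ltW.
Qed.

Lemma ExD f g : bmeas f -> bmeas g -> Ex (fun t => f t + g t) = Ex f + Ex g.
Proof. by move=> bf bg; rewrite /Ex RintegralD//; exact: bmeas_integrable. Qed.

Lemma ExB f g : bmeas f -> bmeas g -> Ex (fun t => f t - g t) = Ex f - Ex g.
Proof. by move=> bf bg; rewrite /Ex RintegralB//; exact: bmeas_integrable. Qed.

Lemma ExZ a f : bmeas f -> Ex (fun t => a * f t) = a * Ex f.
Proof. by move=> bf; rewrite /Ex RintegralZl//; exact: bmeas_integrable. Qed.

Lemma ExN f : bmeas f -> Ex (fun t => - f t) = - Ex f.
Proof.
move=> bf; rewrite -mulN1r -ExZ//; congr Ex.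
by apply/funext => t; rewrite mulN1r.
Qed.

Lemma Ex_ge0 f : (forall t, 0 <= t -> 0 <= f t) -> 0 <= Ex f.
Proof. by move=> f0; apply: Rintegral_ge0 => t; exact: f0. Qed.

Lemma Ex_le f g : bmeas f -> bmeas g -> (forall t, 0 <= t -> f t <= g t) ->
  Ex f <= Ex g.
Proof.
by move=> bf bg fg; apply: le_Rintegral => //; exact: bmeas_integrable.
Qed.

Lemma eq_Ex f g : (forall t, 0 <= t -> f t = g t) -> Ex f = Ex g.
Proof. by move=> fg; apply: eq_Rintegral => t /set_mem; exact: fg. Qed.

Lemma setC_Rplus : ~` Rplus R = [set t | t < 0].
Proof. by apply/seteqP; split=> t /=; rewrite ltNge => /negP. Qed.

Lemma nu_RplusE : nu (Rplus R) = 1%E.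
Proof.
have := probability_setC nu measurable_Rplus.
rewrite setC_Rplus (nu_Rplus : nu _ = 0%E) => /esym/eqP.
by rewrite sube_eq ?adde_def// ?add0e => /eqP.
Qed.

Lemma Ex_cst a : Ex (fun=> a) = a.
Proof.
rewrite /Ex Rintegral_cst//.
by rewrite [X in fine X](_ : _ = 1%E) ?mulr1//; exact: nu_RplusE.
Qed.

(** Expand the nonnegative variance of [f]; the mean of a constant is that constant because the mass
    of R_+ is 1. *)
Lemma sqr_Ex_le f : bmeas f -> Ex f ^+ 2 <= Ex (fun t => f t ^+ 2).
Proof.
move=> bf; have : 0 <= Ex (fun t => (f t ^+ 2 - (2 * Ex f) * f t) + Ex f ^+ 2).
  apply: Ex_ge0 => t _; rewrite (_ : _ + _ = (f t - Ex f) ^+ 2) ?sqr_ge0//; ring.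
rewrite ExD; last 2 first.
- by apply: bmeasB; [exact: bmeasX|apply: bmeasM => //; exact: bmeas_cst].
- exact: bmeas_cst.
rewrite ExB; last 2 first.
- exact: bmeasX.
- by apply: bmeasM => //; exact: bmeas_cst.
rewrite ExZ// Ex_cst => h; lra.
Qed.

Lemma cintD F G : cbmeas F -> cbmeas G ->
  cint nu (fun t => F t + G t) = cint nu F + cint nu G.
Proof.
move=> [? ?] [? ?]; apply: complexP; rewrite ?partsE /= -?/(Ex _).
- by rewrite -ExD//; apply: eq_Ex => t _; rewrite partsE.
- by rewrite -ExD//; apply: eq_Ex => t _; rewrite partsE.
Qed.

Lemma cintZ (a : R[i]) F : cbmeas F -> cint nu (fun t => a * F t) = a * cint nu F.
Proof.
move=> [b1 b2]; have := bmeas_cst (Re a); have := bmeas_cst (Im a) => bi br.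
apply: complexP; rewrite ?partsE /= -?/(Ex _).
- rewrite -!ExZ// -ExB//; try exact: bmeasM.
  by apply: eq_Ex => t _; rewrite partsE.
- rewrite -!ExZ// -ExD//; try exact: bmeasM.
  by apply: eq_Ex => t _; rewrite partsE.
Qed.

Lemma cintN F : cbmeas F -> cint nu (fun t => - F t) = - cint nu F.
Proof.
move=> bF; rewrite -mulN1r -cintZ//; congr cint.
by apply/funext => t; rewrite mulN1r.
Qed.

Lemma cintJ F : cbmeas F -> cint nu (fun t => conjc (F t)) = conjc (cint nu F).
Proof.
move=> [? ?]; apply: complexP; rewrite ?partsE /= -?/(Ex _).
- by apply: eq_Ex => t _; rewrite partsE.
- by rewrite -ExN//; apply: eq_Ex => t _; rewrite partsE.
Qed.

Lemma cint_cst a : cint nu (fun=> a) = a.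
Proof. by apply: complexP; rewrite /= -/(Ex _) Ex_cst. Qed.

Lemma eq_cint F G : (forall t, 0 <= t -> F t = G t) -> cint nu F = cint nu G.
Proof.
by move=> FG; apply: complexP; rewrite /=; apply: eq_Ex => t t0; rewrite FG.
Qed.

Lemma nrm2_cint_le F : cbmeas F -> nrm2 (cint nu F) <= Ex (fun t => nrm2 (F t)).
Proof.
move=> [b1 b2]; rewrite /nrm2 /= -!/(Ex _) ExD; [|exact: bmeasX..].
by rewrite lerD// sqr_Ex_le.
Qed.

Hypothesis nu_n0 : ~ (forall A : set R, measurable A -> nu A = \d_(0 : R) A).

(** If the positive half-line were null, all the mass would sit at 0 and [nu] would agree with the
    Dirac mass on every measurable [A], according to whether [A] contains 0. *)
Lemma nu_pos_gt0 : (0 < nu [set t : R | (0 < t)%R])%E.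
Proof.
rewrite lt0e measure_ge0 andbT; apply/negP => /eqP nu0; apply: nu_n0 => A mA.
have mp := measurable_pos.
have mn : measurable [set t : R | t < 0] by rewrite -setC_Rplus; exact: measurableC.
have nuN : nu (~` [set 0 : R]) = 0%E.
  apply/eqP; rewrite eq_le measure_ge0 andbT.
  rewrite (_ : ~` [set 0 : R] = [set t : R | t < 0] `|` [set t : R | 0 < t]); last first.
    apply/seteqP; split=> t /=; first by move=> /eqP; rewrite neq_lt => /orP.
    by move=> /orP; rewrite -neq_lt => /eqP.
  apply: (le_trans (measureU2 _ mn mp)).
  rewrite [X in (X + _)%E](_ : _ = 0%E); last exact: nu_Rplus.
  by rewrite [X in (_ + X)%E](_ : _ = 0%E) ?adde0.
have nu1 : nu [set 0 : R] = 1%E.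
  have := probability_setC nu (measurable_set1 (0 : R)).
  rewrite nuN => /esym/eqP.
  by rewrite sube_eq ?adde_def// ?add0e => /eqP.
rewrite diracE; case: (boolP (0 \in A)) => [/set_mem A0|/negP A0].
  apply/eqP; rewrite eq_le probability_le1//= -nu1 le_measure// ?inE//.
  by move=> _ ->.
apply/eqP; rewrite eq_le measure_ge0 andbT -[leRHS]nuN le_measure// ?inE//.
  exact: measurableC.
by move=> t At /= t0; apply: A0; rewrite -t0 inE.
Qed.

(** A zero integral would make [f] vanish almost everywhere, hence make the positive half-line
    null. *)
Lemma Ex_gt0 f : bmeas f -> (forall t, 0 <= t -> 0 <= f t) ->
  (forall t, 0 < t -> 0 < f t) -> 0 < Ex f.
Proof.
move=> bf f0 fp; rewrite lt_neqAle Ex_ge0// andbT; apply/eqP => E0.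
have fin := integrable_fin_num measurable_Rplus (bmeas_integrable bf).
have I0 : (\int[nu]_(t in Rplus R) `|(EFin \o f) t| = 0)%E.
  rewrite -[RHS]/((0 : R)%:E) E0 /Ex /Rintegral fineK//.
  by apply: eq_integral => t /set_mem t0 /=; rewrite ger0_norm// f0.
have [mf _] := bf.
have /ae_eq_integral_abs : measurable_fun (Rplus R) (EFin \o f).
  by apply/measurable_EFinP; exact: measurable_funTS.
move=> /(_ nu measurable_Rplus)/iffLR/(_ I0)[N [mN N0 sN]].
have := nu_pos_gt0; rewrite ltNge => /negP; apply.
rewrite -N0 le_measure// ?inE//; first exact: measurable_pos.
move=> t /= t0; apply: sN => /= /(_ (ltW t0)) [].
by apply/eqP; rewrite gt_eqF// fp.
Qed.

End Expectation.

(** * Convergence of means under an L^2 bound *)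

Section L2BoundedConvergence.
Context {R : realType} (nu : probability R R).

(* [|h| <= min(|h|, K) + h^2 / K]: the first term tends to 0 by dominated convergence. *)
Lemma Ex_cvg0_of_L2_bounded (h : nat -> R -> R) (M : R) :
  (forall n, bmeas (h n)) -> (forall n, Ex nu (fun t => h n t ^+ 2) <= M) ->
  (forall t : R, 0 <= t -> h n t @[n --> \oo] --> (0 : R)) ->
  Ex nu (h n) @[n --> \oo] --> (0 : R).
Proof.
move=> bh hM h0.
have bmin (K : R) n : 0 < K -> bmeas (fun t => Num.min `|h n t| K).
  move=> K0; have [mh _] := bh n; split.
    by apply: measurable_minr; [exact: measurableT_comp|exact: measurable_cst].
  by exists K => t; rewrite ger0_norm ?le_min ?normr_ge0 ?(ltW K0)// ge_min lexx orbT.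
have cmin (K : R) : 0 < K -> Ex nu (fun t => Num.min `|h n t| K) @[n --> \oo] --> (0 : R).
  move=> K0.
  have mD := @measurable_Rplus R.
  have mmin n : measurable_fun (Rplus R) (EFin \o (fun t => Num.min `|h n t| K)).
    by apply/measurable_EFinP; apply: measurable_funTS; have [] := bmin K n K0.
  have [||||_ _] := @dominated_convergence _ _ _ nu _ mD
    (fun n => EFin \o (fun t => Num.min `|h n t| K)) (cst 0%E) (cst K%:E) mmin.
  - exact: measurable_cst.
  - apply: aeW => t t0; apply: cvg_EFin; first exact: nearW.
    apply/cvgrPdist_lt => e e0; have /cvgrPdist_lt/(_ e e0) := h0 t t0.
    apply: filterS => n /=; rewrite !sub0r !normrN; apply: le_lt_trans.
    by rewrite ger0_norm ?le_min ?normr_ge0 ?(ltW K0)// ge_min lexx.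
  - exact: bmeas_integrable (bmeas_cst K).
  - apply: aeW => t n _ /=.
    by rewrite lee_fin ger0_norm ?le_min ?normr_ge0 ?(ltW K0)// ge_min lexx orbT.
  by rewrite integral0 => /fine_cvg.
apply/cvgrPdist_lt => e e0.
(* With this [K] the tail term [M / K] is at most [e / 2]; the [+ 1] keeps [K] positive when
   [M = 0]. *)
pose K := 2 * (`|M| + 1) / e.
have K0 : 0 < K by rewrite divr_gt0// mulr_gt0// ltr_pwDr.
have e2 : 0 < e / 2 by rewrite divr_gt0.
have /cvgrPdist_lt/(_ _ e2) := cmin K K0.
apply: filterS => n; rewrite !sub0r !normrN.
rewrite (ger0_norm (Ex_ge0 _ _)); last first.
  by move=> t _; rewrite le_min normr_ge0 ltW.
move=> lt2.
have [mh _] := bh n.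
have le1 : `|Ex nu (h n)| <= Ex nu (fun t => `|h n t|).
  by apply: le_normr_Rintegral; [exact: measurable_Rplus|exact: bmeas_integrable].
have le2 : Ex nu (fun t => `|h n t|) <=
    Ex nu (fun t => Num.min `|h n t| K + K^-1 * h n t ^+ 2).
  apply: Ex_le.
  - exact: bmeas_norm.
  - apply: bmeasD; first exact: bmin.
    by apply: bmeasM; [exact: bmeas_cst|exact: bmeasX].
  move=> t _; rewrite minEle; case: ifPn => [_|]; first by rewrite lerDl mulr_ge0 ?sqr_ge0// invr_ge0 ltW.
  rewrite -ltNge => Kh; rewrite -[leLHS]add0r lerD ?(ltW K0)//.
  rewrite -real_normK ?num_real// expr2 mulrA ler_peMl// mulrC ler_pdivlMr// mul1r.
  exact: ltW.
rewrite (le_lt_trans le1)// (le_lt_trans le2)// ExD; last 2 first.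
- exact: bmin.
- by apply: bmeasM; [exact: bmeas_cst|exact: bmeasX].
rewrite ExZ; last exact: bmeasX.
rewrite [ltRHS](splitr e) ltr_leD//.
rewrite mulrC ler_pdivrMr// (le_trans (hM n))// /K.
rewrite (_ : e / 2 * _ = `|M| + 1); last by field; rewrite gt_eqF.
by rewrite (le_trans (ler_norm M))// lerDl.
Qed.
End L2BoundedConvergence.

(** * Second moments of the kernel and the Cauchy-Schwarz defect *)

Section KernelMoments.
Context {R : realType} (nu : probability R R).
Hypothesis nu_Rplus : supported_Rplus nu.
Hypothesis nu_n0 : ~ (forall A : set R, measurable A -> nu A = \d_(0 : R) A).
Variable c : R.
Hypothesis c_gt0 : 0 < c.
Local Notation Re := complex.Re.
Local Notation Im := complex.Im.
Local Notation E := (Ex nu).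
Implicit Types (w : R[i]) (t L : R).

Definition gam w : R := c * E (fun t => nrm2 (uker w t)).
(** No conjugate is taken: this is the Hermitian pairing of [uker w] with the conjugate of
    [uker w']. That is the form produced by differences of the system, and it is why equality in
    Cauchy-Schwarz relates one boundary value to the conjugate of the other. *)
Definition cov w w' : R[i] := c%:C * cint nu (fun t => uker w t * uker w' t).

Lemma nrm2_uker w t : nrm2 (uker w t) = t ^+ 2 / nrm2 (1 + w * t%:C).
Proof. by rewrite /uker nrm2M nrm2C nrm2V. Qed.

Lemma Im_uker w t : Im (uker w t) = - (Im w * nrm2 (uker w t)).
Proof. by rewrite nrm2_uker /uker !partsE; ring. Qed.

Lemma Im_cint_uker w : Cplus w -> c * Im (cint nu (uker w)) = - (gam w * Im w).
Proof.
move=> w0 /=; rewrite -/(E _) /gam -mulrA -mulrN; congr (c * _).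
rewrite mulrC -mulNr -ExZ; last exact/bmeas_nrm2/cbmeas_uker.
by apply: eq_Ex => t _; rewrite Im_uker mulNr.
Qed.

Lemma gam_ge0 w : 0 <= gam w.
Proof. by rewrite mulr_ge0 ?(ltW c_gt0)// Ex_ge0// => t _; exact: nrm2_ge0. Qed.

Lemma nrm2_cint_uker_le w : Cplus w ->
  nrm2 (c%:C * cint nu (uker w)) <= c * gam w.
Proof.
move=> w0; rewrite nrm2M nrm2C /gam mulrA -expr2 ler_pM2l ?exprn_gt0//.
exact/nrm2_cint_le/cbmeas_uker.
Qed.

(** Over the common denominator, the numerator on the right is [t * Im (z * (1 + w t))], that is
    [t * Im z + t^2 * Im (z * w)]. The first term is nonnegative since [t >= 0]; dropping it leaves
    the left side. *)
Lemma Im_scaled_uker_ge z w t : 0 <= t -> Cplus z -> Cplus w ->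
  Im (z * w) / nrm2 z * nrm2 (uker w t) <= Im ((- z)^-1 * uker w t).
Proof.
move=> t0 z0 w0; have zn := Cplus_neq0 z0; have den := rker_den_neq0 t w0.
have pz : 0 < nrm2 z by rewrite nrm2_gt0.
have pd : 0 < nrm2 (1 + w * t%:C) by rewrite nrm2_gt0.
have -> : Im ((- z)^-1 * uker w t) = Im (z * (1 + w * t%:C)) * t / (nrm2 z * nrm2 (1 + w * t%:C)).
  rewrite -nrm2M (_ : _ * uker w t = - (t%:C * (z * (1 + w * t%:C))^-1)); last first.
    by rewrite /uker; field; rewrite den zn.
  by move: (z * _) => q; rewrite ImN ImM ImC ReC ImV mul0r addr0; ring.
rewrite nrm2_uker -subr_ge0.
have -> : Im (z * (1 + w * t%:C)) = Im z + t * Im (z * w) by rewrite !partsE; ring.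
rewrite (_ : _ - _ = Im z * t / (nrm2 z * nrm2 (1 + w * t%:C))).
  by rewrite divr_ge0 ?mulr_ge0 ?(ltW pz) ?(ltW pd)// ltW.
by field; rewrite !gt_eqF.
Qed.

(** A resolvent identity. Integrated, it factors the difference of the system at two points through
    [cov]. *)
Lemma uker_sub w w' t : Cplus w -> Cplus w' ->
  uker w t - uker w' t = (w' - w) * (uker w t * uker w' t).
Proof. by move=> w0 w0'; rewrite /uker; field; rewrite !rker_den_neq0. Qed.

Lemma cbmeas_ukerM w w' : Cplus w -> Cplus w' ->
  cbmeas (fun t => uker w t * uker w' t).
Proof. by move=> w0 w0'; apply: cbmeasM; exact: cbmeas_uker. Qed.

Lemma cint_uker_sub w w' : Cplus w -> Cplus w' ->
  c%:C * cint nu (uker w) - c%:C * cint nu (uker w') = (w' - w) * cov w w'.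
Proof.
move=> w0 w0'; rewrite /cov mulrCA -(cintZ nu _ (cbmeas_ukerM w0 w0')).
rewrite -mulrBr -cintN -?cintD; [|exact: cbmeas_uker|exact/cbmeasN/cbmeas_uker|exact: cbmeas_uker].
by congr (_ * _); apply: eq_cint => t _; rewrite uker_sub.
Qed.

(** The residual of [uker w] after orthogonal projection on the conjugate of [uker w'], multiplied
    by [gam w'] to avoid a division. *)
Definition vker w w' t : R[i] :=
  (gam w')%:C * uker w t - cov w w' * conjc (uker w' t).

Lemma cbmeas_vker w w' : Cplus w -> Cplus w' -> cbmeas (vker w w').
Proof.
move=> w0 w0'; apply: cbmeasD.
  by apply: cbmeasM; [exact: cbmeas_cst|exact: cbmeas_uker].
apply/cbmeasN/cbmeasM; first exact: cbmeas_cst.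
exact/cbmeasJ/cbmeas_uker.
Qed.

(* The defect in the Cauchy-Schwarz inequality [|cov|^2 <= gam * gam]. *)
Lemma Ex_nrm2_vker w w' : Cplus w -> Cplus w' ->
  c * E (fun t => nrm2 (vker w w' t)) =
  gam w' * (gam w * gam w' - nrm2 (cov w w')).
Proof.
move=> w0 w0'.
set g' := gam w'; set A := cov w w'.
have bu := bmeas_nrm2 (cbmeas_uker w0); have bu' := bmeas_nrm2 (cbmeas_uker w0').
have [br bi] := cbmeas_ukerM w0 w0'.
have -> : E (fun t => nrm2 (vker w w' t)) =
   E (fun t => (g' ^+ 2 * nrm2 (uker w t) + nrm2 A * nrm2 (uker w' t)) -
     ((2 * g' * Re A) * Re (uker w t * uker w' t) +
      (2 * g' * Im A) * Im (uker w t * uker w' t))).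
  apply: eq_Ex => t _; rewrite /vker -/g' -/A /nrm2 !partsE; ring.
have bc a f : bmeas f -> bmeas (fun t => a * f t).
  by move=> ?; apply: bmeasM => //; exact: bmeas_cst.
rewrite ExB; [|apply: bmeasD; exact: bc|apply: bmeasD; exact: bc].
rewrite ExD; [|exact: bc|exact: bc].
rewrite ExD; [|exact: bc|exact: bc].
rewrite !ExZ//.
have e1 : Re A = c * E (fun t => Re (uker w t * uker w' t)).
  by rewrite /A /cov ReM ReC ImC mul0r subr0.
have e2 : Im A = c * E (fun t => Im (uker w t * uker w' t)).
  by rewrite /A /cov ImM ReC ImC mul0r addr0.
rewrite !mulrBr !mulrDr.
rewrite ![c * (_ * _)]mulrCA -e1 -e2 -!/(gam _) -/g' /nrm2; ring.
Qed.

Lemma nrm2_cov_le w w' : Cplus w -> Cplus w' -> 0 < gam w' ->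
  nrm2 (cov w w') <= gam w * gam w'.
Proof.
move=> w0 w0' g0; have := Ex_nrm2_vker w0 w0'.
rewrite -subr_ge0 -(pmulr_rge0 _ g0) => <-.
by rewrite mulr_ge0 ?(ltW c_gt0)// Ex_ge0// => t _; exact: nrm2_ge0.
Qed.

(** Jensen's inequality for [vker]. In the system these two integrals are [- z * d z] at two points,
    so a defect tending to 0 makes the limits of [d] proportional up to conjugation. *)
Lemma nrm2_cint_vker_le w w' : Cplus w -> Cplus w' ->
  nrm2 ((gam w')%:C * (c%:C * cint nu (uker w)) -
        cov w w' * conjc (c%:C * cint nu (uker w'))) <=
  c * (gam w' * (gam w * gam w' - nrm2 (cov w w'))).
Proof.
move=> w0 w0'; rewrite -Ex_nrm2_vker// [leRHS]mulrA -expr2.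
set q := (X in nrm2 X); suff -> : q = c%:C * cint nu (vker w w').
  rewrite nrm2M nrm2C ler_pM2l ?exprn_gt0//.
  exact/nrm2_cint_le/cbmeas_vker.
rewrite /vker cintD; last 2 first.
- by apply: cbmeasM; [exact: cbmeas_cst|exact: cbmeas_uker].
- by apply/cbmeasN/cbmeasM; [exact: cbmeas_cst|exact/cbmeasJ/cbmeas_uker].
rewrite cintZ; last exact: cbmeas_uker.
rewrite cintN; last by apply: cbmeasM; [exact: cbmeas_cst|exact/cbmeasJ/cbmeas_uker].
rewrite cintZ; last exact/cbmeasJ/cbmeas_uker.
rewrite cintJ; last exact: cbmeas_uker.
by rewrite /q conjcM conjcC; ring.
Qed.

Lemma nrm2_den_le w t L : nrm2 w <= L ->
  nrm2 (1 + w * t%:C) <= 2 * (1 + L * t ^+ 2).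
Proof.
move=> wL; apply: le_trans (nrm2D_le _ _) _; rewrite nrm2M nrm2C.
have -> : nrm2 (1 : R[i]) = 1 by rewrite /nrm2 !partsE; ring.
have : nrm2 w * t ^+ 2 <= L * t ^+ 2 by rewrite ler_wpM2r ?sqr_ge0.
by move: (nrm2 w * _) (L * _) => x y; lra.
Qed.

Lemma den_gt0 L t : 1 <= L -> 0 < 1 + L * t ^+ 2.
Proof.
by move=> L1; rewrite ltr_pwDl// mulr_ge0 ?sqr_ge0// (le_trans ler01).
Qed.

Lemma bmeas_inv_den L : 1 <= L -> bmeas (fun t => (1 + L * t ^+ 2)^-1).
Proof.
move=> L1; split.
  apply: measurable_inv_pos => t; first exact: den_gt0.
  apply: cvgD; first exact: cvg_cst.
  apply: cvgM; first exact: cvg_cst.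
  by under eq_fun do rewrite expr2; rewrite expr2; apply: cvgM; exact: cvg_id.
exists 1 => t; rewrite ger0_norm ?invr_ge0 ?(ltW (den_gt0 _ _))//.
rewrite invf_le1 ?den_gt0// lerDl mulr_ge0 ?sqr_ge0//.
by rewrite (le_trans ler01).
Qed.

Lemma bmeas_t_den L : 1 <= L -> bmeas (fun t => t / (1 + L * t ^+ 2)).
Proof.
move=> L1; split; first by apply: measurable_funM => //; case: (bmeas_inv_den L1).
exists 1 => t; have d0 := den_gt0 t L1.
rewrite normrM normfV (gtr0_norm d0) ler_pdivrMr// mul1r.
have : t ^+ 2 <= L * t ^+ 2 by rewrite ler_peMl ?sqr_ge0.
rewrite -(real_normK (num_real t)); have := normr_ge0 t.
move: (`|t|) => s; nra.
Qed.

Lemma bmeas_t2_den L : 1 <= L -> bmeas (fun t => t ^+ 2 / (1 + L * t ^+ 2)).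
Proof.
move=> L1; split.
  apply: measurable_funM; first exact: measurable_funX.
  by case: (bmeas_inv_den L1).
exists 1 => t; have d0 := den_gt0 t L1.
rewrite ger0_norm ?divr_ge0 ?sqr_ge0 ?(ltW d0)// ler_pdivrMr// mul1r.
have : t ^+ 2 <= L * t ^+ 2 by rewrite ler_peMl ?sqr_ge0.
by move/le_trans; apply; rewrite lerDr.
Qed.

(** Lower bounds that depend on [w] only through [nrm2 w <= L], hence uniform up to the real axis.
    They rest on [nrm2 (1 + w t) <= 2 (1 + L t^2)], the source of the halves; [1 <= L] makes the
    three integrands bounded by 1 in absolute value. *)
Definition kap1 L : R := E (fun t => t / (1 + L * t ^+ 2)) / 2.
Definition kap2 L : R := c * (E (fun t => t ^+ 2 / (1 + L * t ^+ 2)) / 2).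
Definition kap4 L : R := c * E (fun t => (t / (1 + L * t ^+ 2)) ^+ 2).

Lemma kap1_gt0 L : 1 <= L -> 0 < kap1 L.
Proof.
move=> L1; rewrite divr_gt0// Ex_gt0//; first exact: bmeas_t_den.
  by move=> t t0; rewrite divr_ge0// ltW// den_gt0.
by move=> t t0; rewrite divr_gt0// den_gt0.
Qed.

Lemma kap2_gt0 L : 1 <= L -> 0 < kap2 L.
Proof.
move=> L1; rewrite mulr_gt0// divr_gt0// Ex_gt0//; first exact: bmeas_t2_den.
  by move=> t t0; rewrite divr_ge0 ?sqr_ge0// ltW// den_gt0.
by move=> t t0; rewrite divr_gt0 ?exprn_gt0// den_gt0.
Qed.

Lemma kap4_gt0 L : 1 <= L -> 0 < kap4 L.
Proof.
move=> L1; rewrite mulr_gt0// Ex_gt0//; first exact/bmeasX/bmeas_t_den.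
  by move=> t t0; rewrite sqr_ge0.
by move=> t t0; rewrite exprn_gt0// divr_gt0// den_gt0.
Qed.

Lemma gam_ge_kap2 w L : 1 <= L -> Cplus w -> nrm2 w <= L -> kap2 L <= gam w.
Proof.
move=> L1 w0 wL; rewrite /kap2 /gam ler_pM2l// mulrC -ExZ; last exact: bmeas_t2_den.
apply: Ex_le.
- by apply: bmeasM; [exact: bmeas_cst|exact: bmeas_t2_den].
- exact/bmeas_nrm2/cbmeas_uker.
move=> t _; have d0 := den_gt0 t L1.
rewrite nrm2_uker mulrCA -invfM ler_wpM2l ?sqr_ge0// lef_pV2 ?posrE ?nrm2_gt0 ?rker_den_neq0 ?mulr_gt0//.
exact: nrm2_den_le.
Qed.

Lemma Ex_tr_ge_kap1 w L : 1 <= L -> Cplus w -> nrm2 w <= L ->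
  kap1 L <= E (fun t => Re (conjc (rker w t) * uker w t)).
Proof.
move=> L1 w0 wL; rewrite /kap1 mulrC -ExZ; last exact: bmeas_t_den.
apply: Ex_le.
- by apply: bmeasM; [exact: bmeas_cst|exact: bmeas_t_den].
- by have [] : cbmeas (fun t => conjc (rker w t) * uker w t);
    [apply: cbmeasM; [exact/cbmeasJ/cbmeas_rker|exact: cbmeas_uker]|].
move=> t t0; have d0 := den_gt0 t L1.
rewrite (_ : Re _ = t * nrm2 (rker w t)); last by rewrite ukerE /nrm2 !partsE; ring.
rewrite /rker nrm2V mulrCA -invfM ler_wpM2l// lef_pV2 ?posrE ?nrm2_gt0 ?rker_den_neq0 ?mulr_gt0//.
exact: nrm2_den_le.
Qed.

(** Over the common denominator [(1 + w t) (1 + conj(w') t)] the numerator of the residual is [t]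
    times an affine function of [t], whose constant coefficient compares [cov w w'] with
    [gam w']. *)
Lemma vker_factor w w' t : Cplus w -> Cplus w' ->
  vker w w' t = t%:C * (rker w t * conjc (rker w' t)) *
   (((gam w')%:C - cov w w') +
    ((gam w')%:C * conjc w' - cov w w' * w) * t%:C).
Proof.
move=> w0 w0'; rewrite /vker !ukerE conjcM conjcC.
have e : rker w t * (1 + w * t%:C) = 1 by rewrite /rker mulVf// rker_den_neq0.
have e' : conjc (rker w' t) * (1 + conjc w' * t%:C) = 1.
  rewrite -(conjcC t) -conjcM -[X in X + _]conjcC -conjcD -conjcM.
  by rewrite /rker mulVf ?conjcC// rker_den_neq0.
set r := rker w t in e *; set r' := conjc _ in e' *.
set g := _%:C; set A := cov _ _; set T := t%:C in e e' *.
transitivity (g * (T * r) * (r' * (1 + conjc w' * T)) - A * (T * r') * (r * (1 + w * T))).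
  by rewrite e e'; ring.
ring.
Qed.

(** Write the affine factor of [vker] as [a + b t], use [|a|^2 <= 2 |a + b t|^2 + 2 |b|^2 t^2], and
    integrate against the weight [(t / (1 + L t^2))^2]. Each of the two denominators of [vker] costs
    a factor 2, whence 8; the weight times [t^2] is at most 1, which gives the term in [b]. *)
Lemma nrm2_vker_ge w w' L : 1 <= L -> Cplus w -> Cplus w' ->
  nrm2 w <= L -> nrm2 w' <= L ->
  nrm2 ((gam w')%:C - cov w w') * kap4 L <=
  2 * c * nrm2 ((gam w')%:C * conjc w' - cov w w' * w) +
  8 * (gam w' * (gam w * gam w' - nrm2 (cov w w'))).
Proof.
move=> L1 w0 w0' wL wL'; rewrite -Ex_nrm2_vker// /kap4.
set a := _ - _; set b := _ - _.
have bd := bmeasX 2 (bmeas_t_den L1).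
have bv := bmeas_nrm2 (cbmeas_vker w0 w0').
rewrite (_ : 2 * c * nrm2 b + _ = c * (2 * nrm2 b + 8 * E (fun t => nrm2 (vker w w' t)))); last by ring.
rewrite mulrCA ler_pM2l// -ExZ//.
rewrite -(Ex_cst nu_Rplus (2 * nrm2 b)) -ExZ// -ExD; last 2 first.
- exact: bmeas_cst.
- by apply: bmeasM => //; exact: bmeas_cst.
apply: Ex_le.
- by apply: bmeasM => //; exact: bmeas_cst.
- apply: bmeasD; first exact: bmeas_cst.
  by apply: bmeasM => //; exact: bmeas_cst.
move=> t _; have d0 := den_gt0 t L1; set D := 1 + L * t ^+ 2 in d0 *.
have ab : nrm2 a <= 2 * nrm2 (a + b * t%:C) + 2 * (nrm2 b * t ^+ 2).
  rewrite -(nrm2C t) -nrm2M -[in X in _ + X]nrm2N; apply: le_trans (nrm2D_le _ _).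
  by rewrite addrK.
have q1 : 0 <= (t / D) ^+ 2 by exact: sqr_ge0.
have q2 : (t / D) ^+ 2 * t ^+ 2 <= 1.
  rewrite -exprMn mulrAC -expr2 expr_le1 ?divr_ge0 ?sqr_ge0 ?(ltW d0)//.
  rewrite ler_pdivrMr// mul1r.
  have : t ^+ 2 <= L * t ^+ 2 by rewrite ler_peMl ?sqr_ge0.
  by move/le_trans; apply; rewrite lerDr.
have q3 : (t / D) ^+ 2 * nrm2 (a + b * t%:C) <= 4 * nrm2 (vker w w' t).
  rewrite vker_factor// -/a -/b !nrm2M nrm2C nrm2J /rker !nrm2V.
  rewrite [X in _ <= X](_ : _ = t ^+ 2 * ((nrm2 (1 + w * t%:C))^-1 * 2) * ((nrm2 (1 + w' * t%:C))^-1 * 2) * nrm2 (a + b * t%:C)); last by ring.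
  rewrite ler_wpM2r ?nrm2_ge0// exprMn -mulrA ler_wpM2l ?sqr_ge0// expr2.
  have k (x : R[i]) : Cplus x -> nrm2 x <= L -> D^-1 <= (nrm2 (1 + x * t%:C))^-1 * 2.
    move=> x0 xL; have p : 0 < nrm2 (1 + x * t%:C) by rewrite nrm2_gt0 rker_den_neq0.
    by rewrite mulrC ler_pdivlMr// mulrC ler_pdivrMr//; exact: nrm2_den_le.
  by rewrite ler_pM ?invr_ge0 ?(ltW d0)// k.
move: ab q1 q2 q3; have := nrm2_ge0 b.
move: (nrm2 a) (nrm2 b) (nrm2 (a + _)) (nrm2 (vker _ _ _)) ((t / D) ^+ 2) (t ^+ 2) => x y s v d q.
nra.
Qed.

End KernelMoments.

(** * The coupled system: a priori bounds *)

Section System.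
Context {R : realType}.
Local Notation Re := complex.Re.
Local Notation Im := complex.Im.

(** The constant [ct], equal to 1 in the theorem, makes the system symmetric, so each fact about [d]
    has a twin about [dt]. Multiplying the equations by [- z] leaves right sides that depend on [z]
    only through [d] and [dt]. *)
Record coupled_system (c ct : R) (nu nut : probability R R) (d dt : R[i] -> R[i]) : Prop :=
  CoupledSystem {
  sys_c : 0 < c;
  sys_ct : 0 < ct;
  sys_nu : supported_Rplus nu;
  sys_nut : supported_Rplus nut;
  sys_nu0 : ~ (forall A : set R, measurable A -> nu A = \d_(0 : R) A);
  sys_nut0 : ~ (forall A : set R, measurable A -> nut A = \d_(0 : R) A);
  sys_d : forall z, Cplus z -> Cplus (d z);
  sys_dt : forall z, Cplus z -> Cplus (dt z);
  sys_eq : forall z, Cplus z -> - z * d z = c%:C * cint nu (uker (dt z));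
  sys_eqt : forall z, Cplus z -> - z * dt z = ct%:C * cint nut (uker (d z)) }.

Lemma coupled_system_sym c ct nu nut d dt :
  coupled_system c ct nu nut d dt -> coupled_system ct c nut nu dt d.
Proof. by case; split. Qed.

Lemma Im_zd c ct nu nut d dt z : coupled_system c ct nu nut d dt -> Cplus z ->
  Im (z * d z) = gam nu c (dt z) * Im (dt z).
Proof.
move=> S z0; apply: oppr_inj; rewrite -(Im_cint_uker nu c (sys_dt S z0)).
by rewrite -ImN -mulNr (sys_eq S z0) ImM ReC ImC mul0r addr0.
Qed.

(** Integrating [Im_scaled_uker_ge] bounds [Im (d z)] below by [gam * Im (z * dt z) / |z|^2]. By the
    twin of [Im_zd], [Im (z * dt z)] is [gamt * Im (d z)], and the positive factor [Im (d z)]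
    cancels. *)
Lemma gam_gamt_le c ct nu nut d dt z : coupled_system c ct nu nut d dt -> Cplus z ->
  gam nu c (dt z) * gam nut ct (d z) <= nrm2 z.
Proof.
move=> S z0; have d0 := sys_d S z0; have dt0 := sys_dt S z0; have c0 := sys_c S.
have zn := Cplus_neq0 z0; have nz : 0 < nrm2 z by rewrite nrm2_gt0.
have Imdt := Im_zd (coupled_system_sym S) z0.
rewrite -(ler_pM2r d0) mulrAC -mulrA [_ * gam nut _ _]mulrC -Imdt.
have -> : Im (d z) = c * Ex nu (fun t => Im ((- z)^-1 * uker (dt z) t)).
  have -> : d z = c%:C * cint nu (fun t => (- z)^-1 * uker (dt z) t).
    rewrite cintZ; last exact: cbmeas_uker.
    by rewrite mulrCA -(sys_eq S z0) mulKf// oppr_eq0.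
  by rewrite ImM ReC ImC mul0r addr0.
have cb : cbmeas (fun t => (- z)^-1 * uker (dt z) t).
  by apply: cbmeasM; [exact: cbmeas_cst|exact: cbmeas_uker].
have := bmeas_nrm2 (cbmeas_uker dt0) => bn.
rewrite [nrm2 z * _]mulrC -ler_pdivrMr// /gam.
rewrite (_ : _ / _ = c * (Im (z * dt z) / nrm2 z * Ex nu (fun t => nrm2 (uker (dt z) t)))); last by ring.
rewrite ler_pM2l// -ExZ//.
apply: Ex_le; first by apply: bmeasM => //; exact: bmeas_cst.
  by case: cb.
by move=> t t0; exact: Im_scaled_uker_ge.
Qed.

Lemma nrm2_zd_le c ct nu nut d dt z : coupled_system c ct nu nut d dt -> Cplus z ->
  nrm2 (z * d z) <= c * gam nu c (dt z).
Proof.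
move=> S z0; rewrite -nrm2N -mulNr (sys_eq S z0).
by apply: nrm2_cint_uker_le; [exact: sys_nu S|exact: sys_c S|exact: sys_dt S _ z0].
Qed.

(** Multiply [|z * dt|^2 <= ct * gamt] by [gam] and use [gam * gamt <= |z|^2]. The left side is [c]
    times the mean of [|dt * uker dt|^2], so this is an L^2 bound uniform in [z]. *)
Lemma nrm2_dt_gam_le c ct nu nut d dt z : coupled_system c ct nu nut d dt -> Cplus z ->
  nrm2 (dt z) * gam nu c (dt z) <= ct.
Proof.
move=> S z0; have nz : 0 < nrm2 z by rewrite nrm2_gt0 Cplus_neq0.
have := nrm2_zd_le (coupled_system_sym S) z0; have := gam_gamt_le S z0.
have := gam_ge0 nu (sys_c S) (dt z); have := sys_ct S; rewrite nrm2M.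
move: (gam _ _ _) (gam _ _ _) (nrm2 (dt z)) => gt g n ct0 g0 h1 h2.
rewrite -(ler_pM2l nz).
have k1 : (nrm2 z * n) * g <= (ct * gt) * g by exact: ler_wpM2r.
have k2 : ct * (g * gt) <= ct * nrm2 z by rewrite ler_pM2l.
lra.
Qed.

(** Forces [dt] to tend to 0 whenever [d] blows up while |z| stays away from 0. *)
Lemma nrm2_d_dt_le c ct nu nut d dt z : coupled_system c ct nu nut d dt -> Cplus z ->
  nrm2 z * (nrm2 (d z) * nrm2 (dt z)) <= c * ct.
Proof.
move=> S z0; have nz : 0 < nrm2 z by rewrite nrm2_gt0 Cplus_neq0.
have := nrm2_dt_gam_le S z0; have := nrm2_zd_le S z0; have := sys_c S.
have := nrm2_ge0 (dt z); rewrite nrm2M.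
move: (gam _ _ _) (nrm2 (dt z)) (nrm2 (d z)) => g n m n0 c0 h1 h2.
have k1 : (nrm2 z * m) * n <= (c * g) * n by exact: ler_wpM2r.
have k2 : c * (n * g) <= c * ct by rewrite ler_pM2l.
lra.
Qed.

Lemma zddt_eq c ct nu nut d dt z : coupled_system c ct nu nut d dt -> Cplus z ->
  - z * d z * dt z = c%:C * cint nu (fun t => dt z * uker (dt z) t).
Proof.
move=> S z0; rewrite cintZ; last exact: cbmeas_uker (sys_dt S z0).
by rewrite (sys_eq S z0) mulrCA mulrC mulrA.
Qed.

Lemma Ex_sqr_Re_le nu F (M : R) : cbmeas F -> Ex nu (fun t => nrm2 (F t)) <= M ->
  Ex nu (fun t => Re (F t) ^+ 2) <= M.
Proof.
move=> bF; apply: le_trans; apply: Ex_le.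
- by have [? _] := bF; exact: bmeasX.
- exact: bmeas_nrm2.
- by move=> t _; rewrite lerDl sqr_ge0.
Qed.

(** Along a sequence with [d] unbounded, [dt] tends to 0. Then [dt * uker dt] tends to 0 and
    [d * uker d] tends to 1 at every [t > 0], so the real part of [- z * d * dt] would tend both to
    0 and to [ct] times the [nut]-mass of the positive half-line. *)
Lemma coupled_system_bounded c ct nu nut d dt (r : R) :
  coupled_system c ct nu nut d dt -> 0 < r ->
  exists K, forall z, Cplus z -> r <= nrm2 z -> nrm2 (d z) <= K.
Proof.
move=> S r0; apply: contrapT => /forallNP unb.
have {unb} /choice[z_ zP] (n : nat) : exists z, [/\ Cplus z, r <= nrm2 z & n.+1%:R < nrm2 (d z)].
  have /existsNP[z /not_implyP[z0 /not_implyP[rz /negP]]] := unb n.+1%:R.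
  by rewrite -ltNge => ?; exists z.
have c0 := sys_c S; have ct0 := sys_ct S.
have zC n : Cplus (z_ n) by case: (zP n).
have dC n := sys_d S (zC n); have dtC n := sys_dt S (zC n).
pose C := c * ct / r.
have C0 : 0 < C by rewrite divr_gt0// mulr_gt0.
have dt_small n : nrm2 (dt (z_ n)) <= C / n.+1%:R.
  have [_ rz dn] := zP n; have := nrm2_d_dt_le S (zC n).
  have n0 := nrm2_ge0 (dt (z_ n)).
  have q0 : 0 < n.+1%:R :> R by rewrite ltr0n.
  rewrite /C ler_pdivlMr// ler_pdivlMr// => /(le_trans _); apply.
  rewrite (_ : _ * r = r * (n.+1%:R * nrm2 (dt (z_ n)))); last by ring.
  rewrite ler_pM ?mulr_ge0 ?(ltW r0) ?(ltW q0)//.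
  by rewrite ler_wpM2r// ltW.
have inv0 (b : R) : b / n.+1%:R @[n --> \oo] --> (0 : R).
  rewrite -[X in _ --> X](mulr0 b); apply: cvgM; first exact: cvg_cst.
  exact: cvg_harmonic.
pose h1 n t := Re (dt (z_ n) * uker (dt (z_ n)) t).
have cb1 n : cbmeas (fun t => dt (z_ n) * uker (dt (z_ n)) t).
  by apply: cbmeasM; [exact: cbmeas_cst|exact: cbmeas_uker].
have h1_0 : Ex nu (h1 n) @[n --> \oo] --> (0 : R).
  apply: (@Ex_cvg0_of_L2_bounded _ nu h1 (ct / c)).
  - by move=> n; case: (cb1 n).
  - move=> n; apply: Ex_sqr_Re_le => //.
    rewrite ler_pdivlMr// mulrC; apply: le_trans (nrm2_dt_gam_le S (zC n)).
    rewrite /gam mulrCA ler_pM2l// -ExZ; last exact/bmeas_nrm2/cbmeas_uker.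
    by rewrite (eq_Ex _ (fun t _ => nrm2M _ _)).
  move=> t _; pose D n := nrm2 (dt (z_ n) * t%:C).
  have Dle n : D n <= C * t ^+ 2 / n.+1%:R.
    by rewrite /D nrm2M nrm2C mulrAC ler_wpM2r ?sqr_ge0.
  (* From [1 <= 2 |1 + dt t|^2 + 2 D], the condition [D <= 1/4] gives [|1 + dt t|^2 >= 1/4]. *)
  have bnd n : D n <= 4^-1 -> h1 n t ^+ 2 <= 4 * D n.
    move=> Dn; have : h1 n t ^+ 2 <= nrm2 (dt (z_ n) * uker (dt (z_ n)) t).
      by rewrite lerDl sqr_ge0.
    move/le_trans; apply; rewrite /uker mulrA nrm2M nrm2V -/(D n).
    have le1 : 1 <= 2 * nrm2 (1 + dt (z_ n) * t%:C) + 2 * D n.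
      rewrite -[D n]nrm2N; apply: le_trans (nrm2D_le _ _).
      by rewrite addrK /nrm2 !partsE expr0n addr0 expr1n.
    have p : 0 < nrm2 (1 + dt (z_ n) * t%:C) by lra.
    rewrite ler_pdivrMr// mulrAC ler_peMl ?nrm2_ge0//; lra.
  have near_small : \forall n \near \oo, D n <= 4^-1.
    have /cvgrPdist_lt/(_ 4^-1) := inv0 (C * t ^+ 2).
    move=> /(_ ltac:(by rewrite invr_gt0)); apply: filterS => n.
    rewrite sub0r normrN => /(le_lt_trans (ler_norm _))/ltW.
    exact: le_trans.
  apply/cvgrPdist_lt => e e0.
  have e20 : 0 < e ^+ 2 by rewrite exprn_gt0.
  have /cvgrPdist_lt/(_ _ e20) := inv0 (4 * (C * t ^+ 2)).
  apply: filterS2 near_small => n /bnd hn.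
  rewrite !sub0r !normrN => /(le_lt_trans (ler_norm _)) lt2.
  rewrite -(@ltr_pXn2r _ 2)// ?nnegrE ?(ltW e0)// real_normK ?num_real//.
  apply: le_lt_trans hn _; apply: le_lt_trans lt2.
  by rewrite -mulrA ler_pM2l.
have mpos := @measurable_pos R.
(* At [t = 0] the kernel [rker] equals 1 whatever [d] is; the indicator removes this point so that
   [h2] below tends to 0 everywhere on R_+. *)
pose ind (t : R) : R := \1_[set t : R | 0 < t] t.
have bind : bmeas ind.
  split; first exact: measurable_indic.
  by exists 1 => t; rewrite /ind indicE; case: (_ \in _); rewrite ?normr1 ?normr0.
have ind1 (t : R) : 0 < t -> ind t = 1.
  by move=> t0; rewrite /ind indicE mem_set.
have ind0 : ind 0 = 0.
  by rewrite /ind indicE memNset//= ltxx.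
pose h2 n t := ind t * Re (rker (d (z_ n)) t).
have bh2 n : bmeas (h2 n) by apply: bmeasM => //; case: (cbmeas_rker (dC n)).
have cb2 n : cbmeas (fun t => d (z_ n) * uker (d (z_ n)) t).
  by apply: cbmeasM; [exact: cbmeas_cst|exact: cbmeas_uker].
have h2_0 : Ex nut (h2 n) @[n --> \oo] --> (0 : R).
  (* The bound comes from [rker = 1 - d * uker d]: its squared modulus is at most
     [2 + 2 |d * uker d|^2], whose second part has mean at most [2 c / ct]. *)
  apply: (@Ex_cvg0_of_L2_bounded _ nut h2 (2 + 2 * (c / ct))) => //.
  - move=> n; have cbr := cbmeas_rker (dC n).
    apply: (@le_trans _ _ (Ex nut (fun t => nrm2 (rker (d (z_ n)) t)))).
      apply: Ex_le; [exact: bmeasX|exact: bmeas_nrm2|move=> t _].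
      rewrite /h2 exprMn; apply: (@le_trans _ _ (Re (rker (d (z_ n)) t) ^+ 2)).
        by rewrite ler_piMl ?sqr_ge0// /ind indicE; case: (_ \in _); rewrite ?expr1n ?expr0n.
      by rewrite lerDl sqr_ge0.
    apply: (@le_trans _ _ (Ex nut (fun t => 2 + 2 * nrm2 (d (z_ n) * uker (d (z_ n)) t)))).
      apply: Ex_le; first exact: bmeas_nrm2.
        by apply: bmeasD; [exact: bmeas_cst|apply: bmeasM; [exact: bmeas_cst|exact: bmeas_nrm2]].
      move=> t _; rewrite uker_rker//.
      have e1 : nrm2 (1 : R[i]) = 1 by rewrite /nrm2 !partsE; ring.
      have := nrm2D_le 1 (- (1 - rker (d (z_ n)) t)).
      by rewrite e1 mulr1 nrm2N opprB addrCA subrr addr0.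
    rewrite ExD; [|exact: bmeas_cst|by apply: bmeasM; [exact: bmeas_cst|exact: bmeas_nrm2]].
    rewrite (Ex_cst (sys_nut S)) ExZ; last exact: bmeas_nrm2.
    rewrite lerD2l ler_pM2l// ler_pdivlMr// mulrC.
    apply: le_trans (nrm2_dt_gam_le (coupled_system_sym S) (zC n)).
    rewrite /gam mulrCA ler_pM2l// -ExZ; last exact/bmeas_nrm2/cbmeas_uker.
    by rewrite (eq_Ex _ (fun t _ => nrm2M _ _)).
  move=> t; rewrite le_eqVlt => /predU1P[<-|t0].
    by rewrite /h2 ind0; under eq_fun do rewrite mul0r; exact: cvg_cst.
  have t20 : 0 < t ^+ 2 by rewrite exprn_gt0.
  (* From [|d t|^2 <= 2 |1 + d t|^2 + 2] and [|d|^2 > n + 1]: once [(n + 1) t^2 >= 4], [|1 + d t|^2]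
     is at least [(n + 1) t^2 / 4]. *)
  have bnd n : 4 / t ^+ 2 <= n.+1%:R -> h2 n t ^+ 2 <= (4 / t ^+ 2) / n.+1%:R.
    move=> hn; have [_ _ dn] := zP n; rewrite /h2 ind1// mul1r.
    apply: (@le_trans _ _ (nrm2 (rker (d (z_ n)) t))); first by rewrite lerDl sqr_ge0.
    rewrite /rker nrm2V.
    have : nrm2 (d (z_ n) * t%:C) <= 2 * nrm2 (1 + d (z_ n) * t%:C) + 2.
      have e1 : nrm2 (- 1 : R[i]) = 1 by rewrite /nrm2 !partsE; ring.
      have := nrm2D_le (1 + d (z_ n) * t%:C) (- 1).
      by rewrite e1 mulr1 addrAC subrr add0r.
    rewrite nrm2M nrm2C.
    have q0 : 0 < n.+1%:R :> R by rewrite ltr0n.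
    have e1 : n.+1%:R * t ^+ 2 <= nrm2 (d (z_ n)) * t ^+ 2 by rewrite ler_pM2r// ltW.
    have e2 : 4 <= n.+1%:R * t ^+ 2 by rewrite -ler_pdivrMr.
    move=> e3; have p : n.+1%:R * t ^+ 2 / 4 <= nrm2 (1 + d (z_ n) * t%:C) by lra.
    have b0 : 0 < n.+1%:R * t ^+ 2 / 4 by rewrite divr_gt0// mulr_gt0.
    rewrite (_ : 4 / t ^+ 2 / n.+1%:R = (n.+1%:R * t ^+ 2 / 4)^-1); last first.
      by move: (n.+1%:R : R) q0 => N N0; field; rewrite !gt_eqF.
    by rewrite lef_pV2// posrE// (lt_le_trans b0).
  apply/cvgrPdist_lt => e e0.
  have e20 : 0 < e ^+ 2 by rewrite exprn_gt0.
  have i1 : \forall n \near \oo, 4 / t ^+ 2 <= n.+1%:R.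
    have /cvgrPdist_lt/(_ 1 ltr01) := inv0 (4 / t ^+ 2).
    apply: filterS => n; rewrite sub0r normrN => /(le_lt_trans (ler_norm _))/ltW.
    by rewrite ler_pdivrMr ?ltr0n// mul1r.
  have /cvgrPdist_lt/(_ _ e20) := inv0 (4 / t ^+ 2).
  apply: filterS2 i1 => n /bnd hn.
  rewrite !sub0r !normrN => /(le_lt_trans (ler_norm _)) lt2.
  rewrite -(@ltr_pXn2r _ 2)// ?nnegrE ?(ltW e0)// real_normK ?num_real//.
  exact: le_lt_trans hn lt2.
pose p := Ex nut ind.
have p0 : 0 < p.
  apply: (Ex_gt0 (sys_nut S) (sys_nut0 S)) => //.
  by move=> t t0; rewrite ind1.
(* Both sides are the real part of [- z * d * dt], computed from the first and from the second
   equation. *)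
have twoE n : c * Ex nu (h1 n) = ct * (p - Ex nut (h2 n)).
  have := zddt_eq S (zC n); have := zddt_eq (coupled_system_sym S) (zC n).
  rewrite mulrAC => -> /(congr1 (@complex.Re R)).
  rewrite !ReM !ReC !ImC !mul0r !subr0 /= -!/(Ex _ _) => <-; congr (_ * _).
  rewrite /p -ExB//; apply: eq_Ex => t; rewrite le_eqVlt => /predU1P[<-|t0].
    by rewrite /h2 ind0 /uker mul0r mulr0 mul0r subr0.
  by rewrite uker_rker// /h2 ind1// mul1r !partsE.
have : c * Ex nu (h1 n) @[n --> \oo] --> c * 0 by apply: cvgM => //; exact: cvg_cst.
have : c * Ex nu (h1 n) @[n --> \oo] --> ct * (p - 0).
  under eq_fun do rewrite twoE; apply: cvgM; first exact: cvg_cst.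
  by apply: cvgB => //; exact: cvg_cst.
move=> l1 l2; have : ct * (p - 0) = c * 0.
  by apply: (cvg_unique _ l1 l2); exact: Rhausdorff.
by rewrite mulr0 subr0 => /eqP; rewrite mulf_eq0 !gt_eqF.
Qed.

End System.

(** * Uniqueness of boundary values, as a statement about scalars *)

Section LimitAlgebra.
Context {R : realType}.
Local Notation Re := complex.Re.
Local Notation Im := complex.Im.

Lemma nrm2_le0 (z : R[i]) : nrm2 z <= 0 -> z = 0.
Proof. by move=> h; apply/eqP; rewrite -nrm2_eq0 eq_le h nrm2_ge0. Qed.

(* Two boundary values at the same real point: equality is forced in the Cauchy-Schwarz
   inequalities for [A] and [B], so that [D] is proportional to the conjugate of [D'];
   then [g' = A] shows that the factor is 1. *)
Lemma boundary_values_unique (x c ct k : R) (D D' Dt Dt' A B : R[i]) (g gt g' gt' : R) :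
  x != 0 -> 0 < k ->
  0 < g -> 0 < gt -> 0 < g' -> 0 < gt' ->
  x%:C * D - x%:C * D' = (Dt - Dt') * A ->
  x%:C * Dt - x%:C * Dt' = (D - D') * B ->
  g * gt <= x ^+ 2 -> g' * gt' <= x ^+ 2 ->
  nrm2 A <= g * g' -> nrm2 B <= gt * gt' ->
  nrm2 (g'%:C * (- x%:C * D) - A * conjc (- x%:C * D')) <= c * (g' * (g * g' - nrm2 A)) ->
  nrm2 (gt'%:C * (- x%:C * Dt) - B * conjc (- x%:C * Dt')) <=
    ct * (gt' * (gt * gt' - nrm2 B)) ->
  nrm2 (g'%:C - A) * k <= 2 * c * nrm2 (g'%:C * conjc Dt' - A * Dt) +
     8 * (g' * (g * g' - nrm2 A)) ->
  0 <= Im D -> 0 <= Im D' -> D = D'.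
Proof.
move=> x0 k0 g0 gt0 g0' gt0' e1 e2 le1 le2 leA leB e3 e4 e5 D0 D0'.
apply: contrapT => /eqP DD'.
have xc : x%:C != 0 :> R[i] by rewrite eq_complex /= negb_and x0.
(* Chaining the two difference equations gives [(D - D') * A * B = x^2 * (D - D')], and [D - D'] is
   nonzero by assumption. *)
have AB : A * B = x%:C ^+ 2.
  apply: (@mulfI _ (D - D')); first by rewrite subr_eq0.
  transitivity (x%:C * ((Dt - Dt') * A)).
    by rewrite [in RHS]mulrA [x%:C * (Dt - Dt')]mulrBr e2; ring.
  by rewrite -e1; ring.
have x2 : 0 < x ^+ 2 by rewrite exprn_even_gt0.
(* The chain [x^4 = |A|^2 |B|^2 <= (g g') (gt gt') = (g gt) (g' gt') <= x^4] collapses, so each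
   inequality in it is an equality; [nA], [gg] and [nB] extract three of them. *)
have nAB : nrm2 A * nrm2 B = x ^+ 2 * x ^+ 2.
  by rewrite -nrm2M AB nrm2M nrm2C.
have nA : nrm2 A = g * g'.
  apply/eqP; rewrite eq_le leA /= leNgt; apply/negP => ltA.
  have : nrm2 A * nrm2 B < (g * g') * (gt * gt').
    apply: (@le_lt_trans _ _ (nrm2 A * (gt * gt'))).
      by rewrite ler_wpM2l ?nrm2_ge0.
    by rewrite ltr_pM2r// mulr_gt0.
  rewrite nAB ltNge => /negP; apply.
  rewrite (_ : g * g' * _ = (g * gt) * (g' * gt')); last by ring.
  by rewrite ler_pM// mulr_ge0// ltW.
have gg : g' * gt' = x ^+ 2.
  apply/eqP; rewrite eq_le le2 /= leNgt; apply/negP => lt2.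
  have : (g * gt) * (g' * gt') < x ^+ 2 * x ^+ 2.
    apply: (@le_lt_trans _ _ (x ^+ 2 * (g' * gt'))).
      by rewrite ler_wpM2r// mulr_ge0// ltW.
    by rewrite ltr_pM2l.
  rewrite -nAB ltNge => /negP; apply.
  rewrite (_ : (g * gt) * _ = (g * g') * (gt * gt')); last by ring.
  by rewrite ler_pM// nrm2_ge0.
have nB : nrm2 B = gt * gt'.
  apply/eqP; rewrite eq_le leB /= leNgt; apply/negP => ltB.
  have : nrm2 A * nrm2 B < (g * g') * (gt * gt').
    by rewrite nA ltr_pM2l// mulr_gt0.
  rewrite nAB ltNge => /negP; apply.
  rewrite (_ : g * g' * _ = (g * gt) * (g' * gt')); last by ring.
  by rewrite ler_pM// mulr_ge0// ltW.
move: e3 e4 e5; rewrite nA nB !subrr !mulr0 addr0 => /nrm2_le0 e3 /nrm2_le0 e4 e5.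
have {}e3 : g'%:C * D = A * conjc D'.
  apply: (@mulfI _ (- x%:C)); first by rewrite oppr_eq0.
  apply/eqP; rewrite -subr_eq0 -[X in _ == X]e3; apply/eqP.
  by rewrite conjcM -[- x%:C](rmorphN) conjcC; ring.
have {}e4 : gt'%:C * Dt = B * conjc Dt'.
  apply: (@mulfI _ (- x%:C)); first by rewrite oppr_eq0.
  apply/eqP; rewrite -subr_eq0 -[X in _ == X]e4; apply/eqP.
  by rewrite conjcM -[- x%:C](rmorphN) conjcC; ring.
have gt'n : gt'%:C != 0 :> R[i] by rewrite eq_complex /= negb_and gt_eqF.
(* Multiplied by [gt'], the two terms become [x^2 * conj(Dt')] and [A * B * conj(Dt')], which agree.
   With the defect zero as well, [e5] leaves only [g' = A]. *)
have b0 : g'%:C * conjc Dt' - A * Dt = 0.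
  apply: (@mulfI _ gt'%:C) => //; rewrite mulr0 mulrBr.
  rewrite [X in _ - X]mulrCA e4 mulrA -rmorphM /= [gt' * g']mulrC gg mulrA AB.
  by rewrite rmorphXn /= subrr.
move: e5; rewrite b0 [nrm2 0](_ : _ = 0) ?mulr0; last by rewrite /nrm2 /= expr0n addr0.
rewrite pmulr_lle0// => /nrm2_le0/eqP; rewrite subr_eq0 => /eqP gA.
have : D = conjc D'.
  apply: (@mulfI _ g'%:C); first by rewrite eq_complex /= negb_and gt_eqF.
  by rewrite e3 -gA.
move=> DJ; move/eqP: DD'; apply; apply: complexP; first by rewrite DJ ReJ.
have := congr1 (@complex.Im R) DJ; rewrite ImJ => ?; lra.
Qed.

End LimitAlgebra.

(** * Limits of complex-valued functions along a filter *)

Section ComplexLimits.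
Context {R : realType} {T : Type}.
Local Notation Re := complex.Re.
Local Notation Im := complex.Im.
Variable F : set_system T.
Hypothesis PF : ProperFilter F.
Implicit Types (f g : T -> R[i]) (a b : R[i]).

(** Taken by real and imaginary parts, so that only limits of real-valued functions occur. *)
Definition ccvg f a := (Re (f p) @[p --> F] --> Re a) /\ (Im (f p) @[p --> F] --> Im a).

Lemma ccvg_cst a : ccvg (fun=> a) a.
Proof. by split; exact: cvg_cst. Qed.
Lemma ccvgD f g a b : ccvg f a -> ccvg g b -> ccvg (fun p => f p + g p) (a + b).
Proof.
by move=> [? ?] [? ?]; split; under eq_fun do rewrite partsE; rewrite partsE; exact: cvgD.
Qed.
Lemma ccvgN f a : ccvg f a -> ccvg (fun p => - f p) (- a).
Proof.
by move=> [? ?]; split; under eq_fun do rewrite partsE; rewrite partsE; exact: cvgN.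
Qed.
Lemma ccvgM f g a b : ccvg f a -> ccvg g b -> ccvg (fun p => f p * g p) (a * b).
Proof.
move=> [? ?] [? ?]; split; under eq_fun do rewrite partsE; rewrite partsE.
- by apply: cvgB; exact: cvgM.
- by apply: cvgD; exact: cvgM.
Qed.
Lemma ccvgJ f a : ccvg f a -> ccvg (fun p => conjc (f p)) (conjc a).
Proof.
by move=> [? ?]; split; under eq_fun do rewrite partsE; rewrite partsE //; exact: cvgN.
Qed.
Lemma ccvgC (f : T -> R) (a : R) : f @ F --> a -> ccvg (fun p => (f p)%:C) a%:C.
Proof. by move=> ?; split=> //=; exact: cvg_cst. Qed.
Lemma cvg_nrm2 f a : ccvg f a -> nrm2 (f p) @[p --> F] --> nrm2 a.
Proof.
move=> [? ?]; rewrite /nrm2; under eq_fun do rewrite !expr2; rewrite !expr2.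
by apply: cvgD; exact: cvgM.
Qed.

Lemma cvg_near_le (f g : T -> R) (a b : R) : f p @[p --> F] --> a ->
  g p @[p --> F] --> b -> (\forall p \near F, f p <= g p) -> a <= b.
Proof.
move=> fa gb fg; rewrite -subr_ge0.
apply: (@closed_cvg _ _ F PF (fun p => g p - f p) [set y | 0 <= y]).
- exact: closed_ge.
- by apply: filterS fg => p /=; rewrite subr_ge0.
- exact: cvgB.
Qed.

Lemma ccvg_near_eq f g a b : ccvg f a -> ccvg g b -> (\forall p \near F, f p = g p) -> a = b.
Proof.
move=> fa gb fg; apply/eqP; rewrite -subr_eq0; apply/eqP/nrm2_le0.
have h := cvg_nrm2 (ccvgD fa (ccvgN gb)).
apply: (cvg_near_le h (g := fun=> 0)); first exact: cvg_cst.
apply: filterS fg => p ->; rewrite subrr /nrm2 /= expr0n addr0//.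
Qed.

(** The image ultrafilter has a cluster point in a compact segment, and an ultrafilter converges to
    each of its cluster points. *)
Lemma ultra_bounded_cvg (f : T -> R) (M : R) : UltraFilter F -> (\forall p \near F, `|f p| <= M) ->
  exists l : R, f p @[p --> F] --> l.
Proof.
move=> FU fM; have [|l [_ cl]] := @segment_compact R (- M) M (f @ F) _.
  by apply: filterS fM => p; rewrite /= in_itv /= ler_norml.
exists l => V Vl; have [//|FC] := in_ultra_setVsetC (f @^-1` V) FU.
by have [y []] := cl (~` V) V FC Vl.
Qed.

Lemma ultra_nrm2_bounded_ccvg f (M : R) : UltraFilter F -> (\forall p \near F, nrm2 (f p) <= M) ->
  exists a, ccvg f a.
Proof.
move=> FU fM.
have [|r hr] := @ultra_bounded_cvg (fun p => Re (f p)) (Num.sqrt `|M|) FU.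
  apply: filterS fM => p h; apply: le_trans (Re_le_cabs _) _.
  by rewrite cabs_le_nrm2 ?sqrtr_ge0// sqr_sqrtr// (le_trans h)// ler_norm.
have [|i hi] := @ultra_bounded_cvg (fun p => Im (f p)) (Num.sqrt `|M|) FU.
  apply: filterS fM => p h; apply: le_trans (Im_le_cabs _) _.
  by rewrite cabs_le_nrm2 ?sqrtr_ge0// sqr_sqrtr// (le_trans h)// ler_norm.
by exists (Complex r i).
Qed.

End ComplexLimits.

(** * Existence of the boundary limits of the solution *)

Section BoundaryLimits.
Context {R : realType}.
Local Notation Re := complex.Re.
Local Notation Im := complex.Im.
Implicit Types (z : R[i]) (x : R).

Lemma nrm2_near_real x z : cabs (z - x%:C) < `|x| / 2 ->
  x ^+ 2 / 4 <= nrm2 z <= 4 * x ^+ 2.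
Proof.
move=> zx; have x0 := normr_ge0 x; have z0 := cabs_ge0 z.
have cx : cabs x%:C = `|x| by rewrite /cabs /= expr0n addr0 sqrtr_sqr.
have h1 : cabs z <= cabs (z - x%:C) + `|x|.
  by rewrite -cx -[in leLHS](subrK x%:C z); exact: cabsD.
have h2 : `|x| <= cabs (z - x%:C) + cabs z.
  by rewrite cabs_dist -cx -[in leLHS](subrK z x%:C); exact: cabsD.
rewrite -sqr_cabs -(real_normK (num_real x)).
by apply/andP; split; nra.
Qed.

Lemma ccvg_to_real {T : Type} (F : set_system T) (FF : Filter F) (f : T -> R[i]) x :
  (forall r, 0 < r -> \forall p \near F, cabs (f p - x%:C) < r) -> ccvg F f x%:C.
Proof.
move=> h; split; apply/cvgrPdist_lt => e /h; apply: filterS => p; apply: le_lt_trans.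
- by rewrite -normrN opprB -ReN -ReD; exact: Re_le_cabs.
- by rewrite -normrN opprB -ImN -ImD; exact: Im_le_cabs.
Qed.

(** The filter lives on pairs [(z, z')] because [cov] couples two points. On an ultrafilter of pairs
    that violate the estimate, all the bounded scalars converge at once; [boundary_values_unique]
    then gives [D = D'], against [e <= nrm2 (D - D')]. *)
Lemma coupled_system_cauchy c ct nu nut d dt x (e : R) :
  coupled_system c ct nu nut d dt -> x != 0 -> 0 < e ->
  exists2 r : R, 0 < r & forall z z', Cplus z -> Cplus z' ->
    cabs (z - x%:C) < r -> cabs (z' - x%:C) < r -> nrm2 (d z - d z') < e.
Proof.
move=> S x0 e0; apply: contrapT => /forall2NP far.
pose B (r : R) := [set p : R[i] * R[i] | [/\ Cplus p.1, Cplus p.2,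
  cabs (p.1 - x%:C) < r, cabs (p.2 - x%:C) < r & e <= nrm2 (d p.1 - d p.2)]].
pose F0 := filter_from [set r : R | 0 < r] B.
have F0P : ProperFilter F0.
  apply: filter_from_proper.
    apply: filter_from_filter; first by exists 1; exact: ltr01.
    move=> r s /= r0 s0; exists (Num.min r s); first by rewrite lt_min r0.
    by move=> p [? ?]; rewrite !lt_min => /andP[? ?] /andP[? ?] ?; split.
  move=> r /= r0; have [//|/existsNP[z /existsNP[z' h]]] := far r.
  move/not_implyP: h => [h1 /not_implyP[h2 /not_implyP[h3 /not_implyP[h4 /negP]]]].
  by rewrite -leNgt => h5; exists (z, z').
have [G [GU sG]] := ultraFilterLemma F0P.
have PG : ProperFilter G by exact: ultra_proper.
have nearB r : 0 < r -> \forall p \near G, B r p by move=> r0; apply: sG; exists r.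
have r0 : 0 < `|x| / 2 by rewrite divr_gt0// normr_gt0.
have c0 := sys_c S; have ct0 := sys_ct S.
have x20 : 0 < x ^+ 2 by rewrite exprn_even_gt0.
have x4 : 0 < x ^+ 2 / 4 by rewrite divr_gt0.
have [K KP] := coupled_system_bounded S x4.
have [Kt KtP] := coupled_system_bounded (coupled_system_sym S) x4.
pose L := 1 + `|K| + `|Kt|.
have L1 : 1 <= L by rewrite /L -addrA lerDl addr_ge0.
have dL z : Cplus z -> x ^+ 2 / 4 <= nrm2 z -> nrm2 (d z) <= L.
  move=> z0 /(KP _ z0)/le_trans; apply; rewrite /L.
  by have := ler_norm K; have := normr_ge0 Kt; lra.
have dtL z : Cplus z -> x ^+ 2 / 4 <= nrm2 z -> nrm2 (dt z) <= L.
  move=> z0 /(KtP _ z0)/le_trans; apply; rewrite /L.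
  by have := ler_norm Kt; have := normr_ge0 K; lra.
pose k := kap2 nu c L; pose kt := kap2 nut ct L.
have k0 : 0 < k by apply: kap2_gt0 => //; [exact: sys_nu S|exact: sys_nu0 S].
have kt0 : 0 < kt by apply: kap2_gt0 => //; [exact: sys_nut S|exact: sys_nut0 S].
have gk z : Cplus z -> x ^+ 2 / 4 <= nrm2 z -> k <= gam nu c (dt z).
  by move=> z0 zx; apply: gam_ge_kap2 => //; [exact: sys_dt S _ z0|exact: dtL].
have gkt z : Cplus z -> x ^+ 2 / 4 <= nrm2 z -> kt <= gam nut ct (d z).
  by move=> z0 zx; apply: gam_ge_kap2 => //; [exact: sys_d S _ z0|exact: dL].
(* An upper bound for one [gam] follows from the lower bound for the other, since their product is
   at most [|z|^2 <= 4 x^2]. *)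
pose M := 4 * x ^+ 2 / kt; pose Mt := 4 * x ^+ 2 / k.
have gM z : Cplus z -> x ^+ 2 / 4 <= nrm2 z <= 4 * x ^+ 2 -> gam nu c (dt z) <= M.
  move=> z0 /andP[zx zx4]; rewrite /M ler_pdivlMr//.
  apply: le_trans zx4; apply: le_trans (gam_gamt_le S z0).
  by rewrite ler_wpM2l ?gkt// gam_ge0.
have gMt z : Cplus z -> x ^+ 2 / 4 <= nrm2 z <= 4 * x ^+ 2 -> gam nut ct (d z) <= Mt.
  move=> z0 /andP[zx zx4]; rewrite /Mt ler_pdivlMr//.
  apply: le_trans zx4; apply: le_trans (gam_gamt_le (coupled_system_sym S) z0).
  by rewrite ler_wpM2l ?gk// gam_ge0.
have near0 : \forall p \near G, [/\ Cplus p.1, Cplus p.2,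
    x ^+ 2 / 4 <= nrm2 p.1 <= 4 * x ^+ 2 & x ^+ 2 / 4 <= nrm2 p.2 <= 4 * x ^+ 2].
  by apply: filterS (nearB _ r0) => p [? ? /nrm2_near_real ? /nrm2_near_real ?].
have cz : ccvg G (fun p => p.1) x%:C.
  by apply: ccvg_to_real => r /nearB; apply: filterS => p [].
have cz' : ccvg G (fun p => p.2) x%:C.
  by apply: ccvg_to_real => r /nearB; apply: filterS => p [].
have [|D cD] := @ultra_nrm2_bounded_ccvg _ _ G PG (fun p => d p.1) L GU.
  by apply: filterS near0 => p [? ? /andP[? ?] /andP[? ?]]; exact: dL.
have [|D' cD'] := @ultra_nrm2_bounded_ccvg _ _ G PG (fun p => d p.2) L GU.
  by apply: filterS near0 => p [? ? /andP[? ?] /andP[? ?]]; exact: dL.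
have [|Dt cDt] := @ultra_nrm2_bounded_ccvg _ _ G PG (fun p => dt p.1) L GU.
  by apply: filterS near0 => p [? ? /andP[? ?] /andP[? ?]]; exact: dtL.
have [|Dt' cDt'] := @ultra_nrm2_bounded_ccvg _ _ G PG (fun p => dt p.2) L GU.
  by apply: filterS near0 => p [? ? /andP[? ?] /andP[? ?]]; exact: dtL.
have [|g cg] := @ultra_bounded_cvg _ _ G PG (fun p => gam nu c (dt p.1)) M GU.
  by apply: filterS near0 => p [? ? ? ?]; rewrite ger0_norm ?gam_ge0// gM.
have [|g' cg'] := @ultra_bounded_cvg _ _ G PG (fun p => gam nu c (dt p.2)) M GU.
  by apply: filterS near0 => p [? ? ? ?]; rewrite ger0_norm ?gam_ge0// gM.
have [|gt cgt] := @ultra_bounded_cvg _ _ G PG (fun p => gam nut ct (d p.1)) Mt GU.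
  by apply: filterS near0 => p [? ? ? ?]; rewrite ger0_norm ?gam_ge0// gMt.
have [|gt' cgt'] := @ultra_bounded_cvg _ _ G PG (fun p => gam nut ct (d p.2)) Mt GU.
  by apply: filterS near0 => p [? ? ? ?]; rewrite ger0_norm ?gam_ge0// gMt.
have covle z z' : Cplus z -> Cplus z' -> x ^+ 2 / 4 <= nrm2 z' ->
    nrm2 (cov nu c (dt z) (dt z')) <= gam nu c (dt z) * gam nu c (dt z').
  move=> z0 z0' zx; apply: nrm2_cov_le => //; [exact: sys_dt S _ z0|exact: sys_dt S _ z0'|].
  exact: lt_le_trans k0 (gk _ z0' zx).
have covlet z z' : Cplus z -> Cplus z' -> x ^+ 2 / 4 <= nrm2 z' ->
    nrm2 (cov nut ct (d z) (d z')) <= gam nut ct (d z) * gam nut ct (d z').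
  move=> z0 z0' zx; apply: nrm2_cov_le => //; [exact: sys_d S _ z0|exact: sys_d S _ z0'|].
  exact: lt_le_trans kt0 (gkt _ z0' zx).
have [|A cA] := @ultra_nrm2_bounded_ccvg _ _ G PG (fun p => cov nu c (dt p.1) (dt p.2)) (M * M) GU.
  apply: filterS near0 => p [h1 h2 h3 h4]; have /andP[h5 _] := h4.
  by rewrite (le_trans (covle _ _ h1 h2 h5))// ler_pM ?gam_ge0// gM.
have [|Bb cB] := @ultra_nrm2_bounded_ccvg _ _ G PG (fun p => cov nut ct (d p.1) (d p.2)) (Mt * Mt) GU.
  apply: filterS near0 => p [h1 h2 h3 h4]; have /andP[h5 _] := h4.
  by rewrite (le_trans (covlet _ _ h1 h2 h5))// ler_pM ?gam_ge0// gMt.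
have DD : D = D'.
  apply: (@boundary_values_unique _ x c ct (kap4 nu c L) D D' Dt Dt' A Bb g gt g' gt') => //.
  - by apply: kap4_gt0 => //; [exact: sys_nu S|exact: sys_nu0 S].
  (* Strict positivity of the limit of [gam] survives because [k] does not depend on the point. *)
  - apply: lt_le_trans k0 _; apply: (cvg_near_le PG (cvg_cst k) cg).
    by apply: filterS near0 => p [? ? /andP[? ?] ?]; exact: gk.
  - apply: lt_le_trans kt0 _; apply: (cvg_near_le PG (cvg_cst kt) cgt).
    by apply: filterS near0 => p [? ? /andP[? ?] ?]; exact: gkt.
  - apply: lt_le_trans k0 _; apply: (cvg_near_le PG (cvg_cst k) cg').
    by apply: filterS near0 => p [? ? _ /andP[? ?]]; exact: gk.
  - apply: lt_le_trans kt0 _; apply: (cvg_near_le PG (cvg_cst kt) cgt').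
    by apply: filterS near0 => p [? ? _ /andP[? ?]]; exact: gkt.
  - apply: (ccvg_near_eq PG
      (ccvgD PG (ccvgM PG cz cD) (ccvgN PG (ccvgM PG cz' cD')))
      (ccvgM PG (ccvgD PG cDt (ccvgN PG cDt')) cA)).
    apply: filterS near0 => p [z0 z0' _ _].
    have := cint_uker_sub nu c (sys_dt S z0) (sys_dt S z0').
    rewrite -(sys_eq S z0) -(sys_eq S z0') => h.
    transitivity (- (- p.1 * d p.1 - - p.2 * d p.2)); first by ring.
    by rewrite h; ring.
  - apply: (ccvg_near_eq PG
      (ccvgD PG (ccvgM PG cz cDt) (ccvgN PG (ccvgM PG cz' cDt')))
      (ccvgM PG (ccvgD PG cD (ccvgN PG cD')) cB)).
    apply: filterS near0 => p [z0 z0' _ _].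
    have := cint_uker_sub nut ct (sys_d S z0) (sys_d S z0').
    rewrite -(sys_eqt S z0) -(sys_eqt S z0') => h.
    transitivity (- (- p.1 * dt p.1 - - p.2 * dt p.2)); first by ring.
    by rewrite h; ring.
  - rewrite -(nrm2C x); apply: (cvg_near_le PG (cvgM cg cgt) (cvg_nrm2 PG cz)).
    by apply: filterS near0 => p [z0 _ _ _]; exact: gam_gamt_le S z0.
  - rewrite -(nrm2C x); apply: (cvg_near_le PG (cvgM cg' cgt') (cvg_nrm2 PG cz')).
    by apply: filterS near0 => p [_ z0 _ _]; exact: gam_gamt_le S z0.
  - apply: (cvg_near_le PG (cvg_nrm2 PG cA) (cvgM cg cg')).
    by apply: filterS near0 => p [? ? _ /andP[? ?]]; exact: covle.
  - apply: (cvg_near_le PG (cvg_nrm2 PG cB) (cvgM cgt cgt')).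
    by apply: filterS near0 => p [? ? _ /andP[? ?]]; exact: covlet.
  - apply: (cvg_near_le PG
      (cvg_nrm2 PG (ccvgD PG (ccvgM PG (ccvgC PG cg') (ccvgM PG (ccvgN PG cz) cD))
        (ccvgN PG (ccvgM PG cA (ccvgJ PG (ccvgM PG (ccvgN PG cz') cD'))))))
      (cvgM (cvg_cst c) (cvgM cg' (cvgB (cvgM cg cg') (cvg_nrm2 PG cA))))).
    apply: filterS near0 => p [z0 z0' _ _].
    rewrite (sys_eq S z0) (sys_eq S z0').
    by apply: nrm2_cint_vker_le => //; [exact: sys_nu S|exact: sys_dt S _ z0|exact: sys_dt S _ z0'].
  - apply: (cvg_near_le PG
      (cvg_nrm2 PG (ccvgD PG (ccvgM PG (ccvgC PG cgt') (ccvgM PG (ccvgN PG cz) cDt))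
        (ccvgN PG (ccvgM PG cB (ccvgJ PG (ccvgM PG (ccvgN PG cz') cDt'))))))
      (cvgM (cvg_cst ct) (cvgM cgt' (cvgB (cvgM cgt cgt') (cvg_nrm2 PG cB))))).
    apply: filterS near0 => p [z0 z0' _ _].
    rewrite (sys_eqt S z0) (sys_eqt S z0').
    by apply: nrm2_cint_vker_le => //; [exact: sys_nut S|exact: sys_d S _ z0|exact: sys_d S _ z0'].
  - have l1 : nrm2 ((gam nu c (dt p.2))%:C - cov nu c (dt p.1) (dt p.2)) * kap4 nu c L
        @[p --> G] --> nrm2 (g'%:C - A) * kap4 nu c L.
      apply: cvgM; last exact: cvg_cst.
      exact: (cvg_nrm2 PG (ccvgD PG (ccvgC PG cg') (ccvgN PG cA))).
    have l2 := cvg_nrm2 PG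
      (ccvgD PG (ccvgM PG (ccvgC PG cg') (ccvgJ PG cDt')) (ccvgN PG (ccvgM PG cA cDt))).
    have l3 : gam nu c (dt p.2) * (gam nu c (dt p.1) * gam nu c (dt p.2) -
        nrm2 (cov nu c (dt p.1) (dt p.2))) @[p --> G] --> g' * (g * g' - nrm2 A).
      by apply: cvgM => //; apply: cvgB; [exact: cvgM|exact: (cvg_nrm2 PG cA)].
    have l4 : 2 * c * nrm2 ((gam nu c (dt p.2))%:C * conjc (dt p.2) - cov nu c (dt p.1) (dt p.2) * dt p.1) +
        8 * (gam nu c (dt p.2) * (gam nu c (dt p.1) * gam nu c (dt p.2) - nrm2 (cov nu c (dt p.1) (dt p.2))))
        @[p --> G] --> 2 * c * nrm2 (g'%:C * conjc Dt' - A * Dt) + 8 * (g' * (g * g' - nrm2 A)).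
      by apply: cvgD; apply: cvgM => //; exact: cvg_cst.
    apply: (cvg_near_le PG l1 l4).
    apply: filterS near0 => p [z0 z0' /andP[zx _] /andP[zx' _]].
    by apply: nrm2_vker_ge => //; [exact: sys_nu S|exact: sys_dt S _ z0|exact: sys_dt S _ z0'|exact: dtL|exact: dtL].
  - apply: (cvg_near_le PG (cvg_cst 0) cD.2).
    by apply: filterS near0 => p [z0 _ _ _]; exact: ltW (sys_d S z0).
  - apply: (cvg_near_le PG (cvg_cst 0) cD'.2).
    by apply: filterS near0 => p [_ z0 _ _]; exact: ltW (sys_d S z0).
have : e <= nrm2 (D - D').
  apply: (cvg_near_le PG (cvg_cst e) (cvg_nrm2 PG (ccvgD PG cD (ccvgN PG cD')))).
  by apply: filterS (nearB _ r0) => p [].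
by rewrite DD subrr leNgt /nrm2 /= expr0n addr0 e0.
Qed.

Definition Cplus_nbhs x : set_system R[i] :=
  filter_from [set r : R | 0 < r] (fun r => [set z | Cplus z /\ cabs (z - x%:C) < r]).

Lemma Cplus_nbhs_proper x : ProperFilter (Cplus_nbhs x).
Proof.
apply: filter_from_proper.
  apply: filter_from_filter; first by exists 1; exact: ltr01.
  move=> r s /= r0 s0; exists (Num.min r s); first by rewrite lt_min r0.
  by move=> p [?]; rewrite !lt_min => /andP[? ?]; split.
move=> r /= r0; exists (Complex x (r / 2)); split; first by rewrite /Cplus /= divr_gt0.
rewrite /cabs !partsE /= subrr expr0n /= add0r oppr0 addr0 sqrtr_sqr gtr0_norm ?divr_gt0//.
by rewrite ltr_pdivrMr// ltr_pMr// ltr1n.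
Qed.

Lemma lim_CplusP (f : R[i] -> R[i]) x (l : R[i]) :
  lim_Cplus f x l <-> ccvg (Cplus_nbhs x) f l.
Proof.
have FF := Cplus_nbhs_proper x; split.
  move=> h; split; apply/cvgrPdist_lt => e /h[r r0 hr]; exists r => // z [z0 zr];
    rewrite distrC; apply: le_lt_trans (hr z z0 zr).
  - by rewrite -ReN -ReD; exact: Re_le_cabs.
  - by rewrite -ImN -ImD; exact: Im_le_cabs.
move=> [/cvgrPdist_lt h1 /cvgrPdist_lt h2] e e0.
have e2 : 0 < e / 2 by rewrite divr_gt0.
have [r r0 hr] := h1 _ e2; have [s s0 hs] := h2 _ e2.
exists (Num.min r s); first by rewrite lt_min r0.
move=> z z0; rewrite lt_min => /andP[zr zs].
apply: le_lt_trans (cabs_le_parts _) _; rewrite !partsE [ltRHS](splitr e).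
by rewrite ltrD// distrC; [apply: hr|apply: hs].
Qed.

(** An ultrafilter supplies a cluster value [D]; passing to the limit in one variable of the Cauchy
    estimate shows that the whole filter converges to [D]. *)
Lemma coupled_system_limit c ct nu nut d dt x :
  coupled_system c ct nu nut d dt -> x != 0 -> exists D : R[i], lim_Cplus d x D.
Proof.
move=> S x0; pose B (r : R) := [set z : R[i] | Cplus z /\ cabs (z - x%:C) < r].
have F0P := Cplus_nbhs_proper x.
have [G [GU sG]] := ultraFilterLemma F0P.
have PG : ProperFilter G by exact: ultra_proper.
have nearB r : 0 < r -> \forall p \near G, B r p by move=> r0; apply: sG; exists r.
have r0 : 0 < `|x| / 2 by rewrite divr_gt0// normr_gt0.
have x4 : 0 < x ^+ 2 / 4 by rewrite divr_gt0// exprn_even_gt0.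
have [K KP] := coupled_system_bounded S x4.
have [|D cD] := @ultra_nrm2_bounded_ccvg _ _ G PG d K GU.
  by apply: filterS (nearB _ r0) => z [z0 /nrm2_near_real/andP[? ?]]; exact: KP.
exists D => e e0.
(* The limit only keeps a non-strict inequality between squares: [e ^+ 2 / 4] gives a distance at
   most [e / 2], hence below [e]. *)
have e4 : 0 < e ^+ 2 / 4 by rewrite divr_gt0// exprn_gt0.
have [r rp h] := coupled_system_cauchy S x0 e4.
exists r => // z z0 zr.
have : nrm2 (d z - D) <= e ^+ 2 / 4.
  apply: (cvg_near_le PG (cvg_nrm2 PG (ccvgD PG (ccvg_cst PG (d z)) (ccvgN PG cD))) (cvg_cst (e ^+ 2 / 4))).
  by apply: filterS (nearB _ rp) => w [w0 wr]; apply/ltW/h.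
move=> le4; apply: (@le_lt_trans _ _ (e / 2)).
  rewrite cabs_le_nrm2 ?divr_ge0 ?(ltW e0)//; move: le4; rewrite expr_div_n.
  by rewrite (_ : 2 ^+ 2 = 4)// -natrX.
by rewrite ltr_pdivrMr// ltr_pMr// ltr1n.
Qed.

End BoundaryLimits.

(** * The Poisson kernel, its primitive, and Tonelli's theorem *)

Section PoissonKernel.
Context {R : realType}.
Local Notation Im := complex.Im.
Local Notation leb := (@lebesgue_measure R).

Definition poisson (y t x : R) : R := y / ((t - x) ^+ 2 + y ^+ 2).

Lemma poisson_den_gt0 (y t x : R) : 0 < y -> 0 < (t - x) ^+ 2 + y ^+ 2.
Proof. by move=> y0; rewrite ltr_wpDl ?sqr_ge0// exprn_gt0. Qed.

Lemma poisson_ge0 (y t x : R) : 0 < y -> 0 <= poisson y t x.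
Proof. by move=> y0; rewrite divr_ge0 ?(ltW y0)// ltW// poisson_den_gt0. Qed.

Lemma Im_stieltjes_kernel (t x y : R) : Im ((t%:C - Complex x y)^-1) = poisson y t x.
Proof. by rewrite ImV /nrm2 !partsE /= add0r sqrrN mulNr opprK. Qed.

(** Rests on [1 + t <= (t - x)^2 + |1 + x| + 1], that is [s <= s^2 + 1] for [s = t - x]. The
    constant degenerates as [y] tends to 0, so it only serves integrability at fixed [y]. *)
Lemma poisson_le_inv (y t x : R) : 0 < y -> 0 <= t ->
  poisson y t x <= (y + (`|1 + x| + 1) / y) * (1 + t)^-1.
Proof.
move=> y0 t0; have d0 := poisson_den_gt0 t x y0.
have t1 : 0 < 1 + t by rewrite ltr_pwDl.
rewrite ler_pdivlMr// /poisson mulrAC ler_pdivrMr//.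
have e : (`|1 + x| + 1) / y * y ^+ 2 = (`|1 + x| + 1) * y by field; rewrite gt_eqF.
have a0 : 0 <= (`|1 + x| + 1) / y * (t - x) ^+ 2.
  by rewrite mulr_ge0 ?sqr_ge0// divr_ge0 ?addr_ge0// ltW.
rewrite mulrDl !mulrDr e.
have n1 := ler_norm (1 + x).
have h : 1 + t <= (t - x) ^+ 2 + (`|1 + x| + 1).
  have := sqr_ge0 (t - x - 1); have := sqr_ge0 (t - x); move: n1; move: (`|1 + x|) => N; lra.
have : y * (1 + t) <= y * ((t - x) ^+ 2 + (`|1 + x| + 1)) by rewrite ler_pM2l.
have y3 : 0 <= y * y ^+ 2 by rewrite mulr_ge0 ?sqr_ge0// ltW.
move: a0 y3; move: (_ / y * _) (y * y ^+ 2) => A B; move: ((t - x) ^+ 2) (`|1 + x|) => C D; lra.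
Qed.

Lemma continuous_poisson (y : R) : 0 < y -> continuous (fun u : R => y / (u ^+ 2 + y ^+ 2)).
Proof.
move=> y0 u; apply: cvgM; first exact: cvg_cst.
apply: cvgV; first by rewrite gt_eqF// ltr_wpDl ?sqr_ge0// exprn_gt0.
apply: cvgD; last exact: cvg_cst.
by under eq_fun do rewrite expr2; rewrite expr2; apply: cvgM; exact: cvg_id.
Qed.

Lemma measurable_poisson_comp d (T : measurableType d) (y : R) (f : T -> R) : 0 < y ->
  measurable_fun setT f -> measurable_fun setT (fun p => y / (f p ^+ 2 + y ^+ 2)).
Proof.
move=> y0 mf; apply: (measurableT_comp (f := fun u : R => y / (u ^+ 2 + y ^+ 2))) => //.
exact: continuous_measurable_fun (continuous_poisson y0).
Qed.

Definition poisson_int (a b y t : R) : R := atan ((b - t) / y) - atan ((a - t) / y).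

Lemma integral_poisson (a b y t : R) : a < b -> 0 < y ->
  (\int[leb]_(x in `[a, b]) (poisson y t x)%:E = (poisson_int a b y t)%:E)%E.
Proof.
move=> ab y0.
have dF (x : R) : is_derive x 1 (fun x : R => atan ((x - t) / y)) (poisson y t x).
  have h : is_derive x 1 (fun x : R => (x - t) / y) y^-1.
    have h1 : is_derive x (1 : R) (fun x : R => x - t) (1 - 0) by exact: is_deriveB.
    have := is_deriveZ y^-1 h1.
    rewrite subr0 [_ *: _]mulr1 => /is_derive_eq; rewrite (_ : _ \*: _ = fun x : R => (x - t) / y); first exact.
    by apply/funext => u; rewrite /= mulrC.
  have := @is_derive1_comp _ atan (fun x : R => (x - t) / y) x _ _ (is_derive1_atan _) h.
  move/is_derive_eq; apply.
  rewrite /poisson; field; rewrite !gt_eqF ?poisson_den_gt0//.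
rewrite (@continuous_FTC2 _ _ (fun x => atan ((x - t) / y)))//.
- apply: continuous_subspaceT => x; rewrite /poisson.
  have -> : (fun x : R => y / ((t - x) ^+ 2 + y ^+ 2)) =
            (fun u : R => y / (u ^+ 2 + y ^+ 2)) \o (fun x => t - x) by [].
  apply: continuous_comp; last exact: continuous_poisson.
  by apply: cvgB; [exact: cvg_cst|exact: cvg_id].
- have cF (x : R) : {for x, continuous (fun x : R => atan ((x - t) / y))}.
    apply: differentiable_continuous; apply/derivable1_diffP.
    by have [] := dF x.
  split.
  + by move=> x _; have [] := dF x.
  + by apply: cvg_at_right_filter; exact: cF.
  + by apply: cvg_at_left_filter; exact: cF.
- by move=> x _; rewrite derive1E; have [] := dF x.
Qed.

Lemma tonelli_lebesgue (mu : {measure set R -> \bar R}) (f : R * R -> \bar R) :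
  sigma_finite setT mu -> measurable_fun setT f -> (forall p, (0 <= f p)%E) ->
  measurable_fun setT (fun x => \int[mu]_t f (x, t))%E /\
  (\int[leb]_x \int[mu]_t f (x, t) = \int[mu]_t \int[leb]_x f (x, t))%E.
Proof.
move=> sf mf f0.
(* Tonelli applies to a measure bundled with its sigma-finiteness; [mu'] is [mu] with that structure
   attached. *)
pose H2 := isSFinite.Build _ _ _ _ (sfinite_measure_sigma_finite sf).
pose H3 := isSigmaFinite.Build _ _ _ _ sf.
pose mu' := HB.pack_for (SigmaFiniteMeasure.type _ R) (Measure.sort mu) H2 H3.
have muE : mu = mu' by exact: eq_measure.
rewrite muE; split.
  by have := @measurable_fun_fubini_tonelli_F _ _ _ _ R mu' f mf f0.
by have := @fubini_tonelli _ _ _ _ R leb mu' f mf f0.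
Qed.

End PoissonKernel.

Lemma setI_itvoo (R : realType) (a b a' b' : R) :
  `]a, b[%classic `&` `]a', b'[%classic = `]Num.max a a', Num.min b b'[%classic.
Proof.
apply/seteqP; split=> x /=; rewrite !in_itv /= gt_max lt_min.
  by move=> [/andP[-> ->] /andP[-> ->]].
by move=> /andP[/andP[-> ->] /andP[-> ->]].
Qed.

Lemma measurable_inv1D (R : realType) :
  measurable_fun (Rplus R) (fun t : R => (1 + t)^-1).
Proof.
(* The absolute value removes the pole at -1: the new function is continuous on the whole line. *)
apply: (@eq_measurable_fun _ _ _ _ _ (fun t : R => (1 + `|t|)^-1)).
  by move=> t /set_mem t0; rewrite ger0_norm.
apply: measurable_funTS; apply: measurable_inv_pos => t; first by rewrite ltr_pwDl.
by apply: cvgD; [exact: cvg_cst|apply: cvg_norm; exact: cvg_id].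
Qed.

Lemma measurable_poisson_int (R : realType) (a b y : R) :
  measurable_fun setT (poisson_int a b y).
Proof.
apply: continuous_measurable_fun => t.
have h (u : R) : {for t, continuous (fun t : R => atan ((u - t) / y))}.
  apply: (@continuous_comp _ _ _ (fun t : R => (u - t) / y) atan); last exact: continuous_atan.
  apply: cvgM; last exact: cvg_cst.
  by apply: cvgB; [exact: cvg_cst|exact: cvg_id].
by apply: cvgB; exact: h.
Qed.

Local Arguments stieltjes : simpl never.

(** * Stieltjes inversion for a measure whose transform has boundary limits *)

Section StieltjesInversion.
Context {R : realType} (mu : {measure set R -> \bar R}).
Local Notation Re := complex.Re.
Local Notation Im := complex.Im.
Local Notation leb := (@lebesgue_measure R).
Hypothesis mu_Rplus : supported_Rplus mu.
Hypothesis mu_fin : forall a b : R, (mu `[a, b] < +oo)%E.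
Hypothesis mu_int : (\int[mu]_(t in Rplus R) ((1 + t)^-1)%:E < +oo)%E.
Let mRp : measurable (Rplus R) := measurable_Rplus.

Lemma mu_sigma_finite : sigma_finite setT mu.
Proof.
exists (fun n : nat => `[- (n%:R : R), n%:R]%classic).
  apply/seteqP; split=> // t _; exists (Num.trunc `|t|).+1 => //=.
  rewrite in_itv /= -ler_norml ltW//.
  exact: truncnS_gt.
by move=> n; split=> //; exact: measurable_itv.
Qed.

Lemma integrable_inv1D : mu.-integrable (Rplus R) (fun t => ((1 + t)^-1)%:E).
Proof.
apply/integrableP; split.
  by apply/measurable_EFinP; exact: measurable_inv1D.
rewrite (eq_integral (fun t : R => ((1 + t)^-1)%:E))// => t /set_mem t0.
by rewrite gee0_abs// lee_fin invr_ge0 addr_ge0.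
Qed.

Lemma integrable_dominated (f : R -> R) (C : R) : measurable_fun setT f ->
  (forall t, 0 <= t -> `|f t| <= C * (1 + t)^-1) ->
  mu.-integrable (Rplus R) (EFin \o f).
Proof.
move=> mf fC; apply: (@le_integrable _ _ _ mu _ mRp _ (fun t => C%:E * ((1 + t)^-1)%:E)%E).
- by apply/measurable_EFinP; exact: measurable_funTS.
- move=> t t0 /=; rewrite lee_fin.
  by rewrite (le_trans (fC _ t0))// ler_norm.
- by apply: integrableZl => //; exact: integrable_inv1D.
Qed.

Lemma measurable_poisson_t (y x : R) : 0 < y -> measurable_fun setT (poisson y ^~ x).
Proof.
move=> y0; apply: (measurable_poisson_comp (f := fun t : R => t - x)) => //.
exact: measurable_funB.
Qed.

Lemma integrable_poisson (y x : R) : 0 < y ->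
  mu.-integrable (Rplus R) (EFin \o poisson y ^~ x).
Proof.
move=> y0; apply: (@integrable_dominated _ (y + (`|1 + x| + 1) / y)).
  exact: measurable_poisson_t.
by move=> t t0; rewrite ger0_norm ?poisson_ge0// poisson_le_inv.
Qed.

Lemma Im_stieltjesE (x y : R) : 0 < y ->
  ((Im (stieltjes mu (Complex x y)))%:E = \int[mu]_(t in Rplus R) (poisson y t x)%:E)%E.
Proof.
move=> y0.
have -> : Im (stieltjes mu (Complex x y)) = Rintegral mu (Rplus R) (fun t => poisson y t x).
  by apply: eq_Rintegral => t _; rewrite Im_stieltjes_kernel.
by rewrite /Rintegral fineK// integrable_fin_num//; exact: integrable_poisson.
Qed.

Lemma integral_Rplus (f : R -> \bar R) : measurable_fun setT f ->
  (forall t, 0 <= f t)%E ->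
  (\int[mu]_(t in Rplus R) f t = \int[mu]_t f t)%E.
Proof.
move=> mf f0; have mN : measurable [set t : R | t < 0] by rewrite -setC_Rplus; exact: measurableC.
rewrite [RHS](@ge0_negligible_integral _ _ _ mu setT [set t : R | t < 0])//.
by congr integral; rewrite setTD -setC_Rplus setCK.
Qed.

Lemma Im_stieltjes_ge0 (x y : R) : 0 < y -> 0 <= Im (stieltjes mu (Complex x y)).
Proof.
move=> y0; rewrite -lee_fin Im_stieltjesE// integral_ge0// => t _.
by rewrite lee_fin poisson_ge0.
Qed.

Variable Fb : R -> R[i].
Hypothesis Fb_lim : forall x : R, x != 0 -> lim_Cplus (stieltjes mu) x (Fb x).

Lemma cabs_Complex (x x' y : R) : cabs (Complex x' y - x%:C) <= `|x' - x| + `|y|.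
Proof. by have := cabs_le_parts (Complex x' y - x%:C); rewrite !partsE /= oppr0 addr0. Qed.

(** The limit is over full half-neighbourhoods, so a point just above [x'] is also admissible for
    the limit at [x]; its transform is close to both boundary values. *)
Lemma boundary_value_close (x e : R) : x != 0 -> 0 < e -> exists2 d : R, 0 < d &
  forall x' : R, x' != 0 -> `|x' - x| < d -> cabs (Fb x' - Fb x) <= e.
Proof.
move=> x0 e0; have [d d0 h] := Fb_lim x0 e0; exists d => // x' x0' xd.
apply/ler_addgt0Pr => e' e0'; have [d' d0' h'] := Fb_lim x0' e0'.
(* Low enough for the limit at [x'], and such that [|x' - x| + y < d] keeps the point admissible at
   [x]. *)
pose y := Num.min (d' / 2) ((d - `|x' - x|) / 2).
have y0 : 0 < y by rewrite lt_min !divr_gt0// subr_gt0.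
have y1 : y < d'.
  by rewrite (@le_lt_trans _ _ (d' / 2))// ?ge_min ?lexx// ltr_pdivrMr// ltr_pMr// ltr1n.
have y2 : `|x' - x| + y < d.
  have : y <= (d - `|x' - x|) / 2 by rewrite ge_min lexx orbT.
  by move: xd; move: (`|_|) => u; lra.
have zC : Cplus (Complex x' y) by [].
have h1 : cabs (stieltjes mu (Complex x' y) - Fb x) < e.
  by apply: h => //; rewrite (le_lt_trans (cabs_Complex _ _ _))// (gtr0_norm y0).
have h2 : cabs (stieltjes mu (Complex x' y) - Fb x') < e'.
  apply: h' => //; rewrite (le_lt_trans (cabs_Complex _ _ _))//.
  by rewrite subrr normr0 add0r gtr0_norm.
have := cabsD (stieltjes mu (Complex x' y) - Fb x) (- (stieltjes mu (Complex x' y) - Fb x')).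
rewrite cabsN opprB addrC addrA subrK; lra.
Qed.

Lemma boundary_Im_continuous (x : R) : x != 0 ->
  {for x, continuous (fun y : R => Im (Fb y))}.
Proof.
move=> x0; apply/cvgrPdist_le => e e0.
have [d d0 h] := boundary_value_close x0 e0.
have x00 : 0 < `|x| by rewrite normr_gt0.
near=> x'; rewrite -normrN opprB -ImN -ImD.
apply: le_trans (Im_le_cabs _) _; apply: h.
  apply/negP => /eqP e1; have : `|x - x'| < `|x|.
    by near: x'; exact: (@cvgr_dist_lt _ _ _ _ _ id x).
  by rewrite e1 subr0 ltxx.
rewrite distrC; near: x'; exact: (@cvgr_dist_lt _ _ _ _ _ id x).
Unshelve. all: by end_near. Qed.

Lemma boundary_Im_ge0 (x : R) : x != 0 -> 0 <= Im (Fb x).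
Proof.
move=> x0; apply/ler_addgt0Pl => e e0; have [d d0 h] := Fb_lim x0 e0.
have y0 : 0 < d / 2 by rewrite divr_gt0.
have /h : Cplus (Complex x (d / 2)) by [].
move=> /(_ _)/ltW; rewrite (le_lt_trans (cabs_Complex _ _ _)); last first.
  by rewrite subrr normr0 add0r gtr0_norm// ltr_pdivrMr// ltr_pMr// ltr1n.
move=> /(_ isT)/(le_trans (Im_le_cabs _)); rewrite ImD ImN ler_norml => /andP[_].
have := Im_stieltjes_ge0 x y0; lra.
Qed.

(** For [x > 0], the kernel equals [1 / y] at [t = x], so the mass of [x] is at most [y] times the
    imaginary part of the transform, which stays bounded near [x]. Negative points are null because
    [mu] lives on R_+. *)
Lemma no_atom (x : R) : x != 0 -> mu [set x] = 0%E.
Proof.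
move=> x0; have [xneg|xpos] := ltP x 0.
  apply/eqP; rewrite eq_le measure_ge0 andbT -[leRHS](mu_Rplus : mu _ = 0%E).
  rewrite le_measure// ?inE//; last by move=> _ ->.
  by rewrite -setC_Rplus; exact: measurableC.
have finx : mu [set x] \is a fin_num.
  rewrite ge0_fin_numE// -set_itv1; exact: mu_fin.
have [d d0 h] := Fb_lim x0 ltr01.
pose M := cabs (Fb x) + 1.
have M0 : 0 < M by rewrite ltr_wpDl// cabs_ge0.
have key (y : R) : 0 < y -> y < d -> fine (mu [set x]) <= M * y.
  move=> y0 yd.
  have IM : Im (stieltjes mu (Complex x y)) <= M.
    have := h (Complex x y) y0; rewrite (le_lt_trans (cabs_Complex _ _ _)); last first.
      by rewrite subrr normr0 add0r gtr0_norm.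
    move=> /(_ isT)/ltW h1.
    apply: le_trans (ler_norm _) _; apply: le_trans (Im_le_cabs _) _.
    rewrite -[in leLHS](subrK (Fb x) (stieltjes _ _)).
    by apply: le_trans (cabsD _ _) _; rewrite /M addrC lerD2l.
  rewrite -ler_pdivrMr// -lee_fin EFinM fineK//.
  rewrite -lee_fin Im_stieltjesE// in IM; apply: le_trans IM.
  rewrite (@le_trans _ _ (\int[mu]_(t in [set x]) (poisson y t x)%:E)%E)//.
    rewrite (eq_integral (cst (y^-1)%:E)); last first.
      move=> t /set_mem ->; congr EFin; rewrite /poisson subrr expr0n add0r.
      by rewrite expr2 invfM mulrA divff ?mul1r// gt_eqF.
    by rewrite integral_cst//= muleC.
  apply: ge0_subset_integral => //.
  - by apply/measurable_EFinP; apply: measurable_funTS; exact: measurable_poisson_t.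
  - by move=> t _; rewrite lee_fin poisson_ge0.
  - by move=> _ ->.
have v0 : 0 <= fine (mu [set x]) by rewrite fine_ge0.
apply/eqP; rewrite -fine_eq0// eq_le v0 andbT.
apply/ler_addgt0Pr => e e0; rewrite add0r.
pose y := Num.min (d / 2) (e / M).
have y0 : 0 < y by rewrite lt_min !divr_gt0.
have yd : y < d.
  by rewrite (@le_lt_trans _ _ (d / 2))// ?ge_min ?lexx// ltr_pdivrMr// ltr_pMr// ltr1n.
apply: (le_trans (key y y0 yd)).
by rewrite mulrC -ler_pdivlMr// ge_min lexx orbT.
Qed.

(** Compactness makes the local estimates uniform. The gap 1 need not be small: it only provides a
    dominating function on the segment. *)
Lemma uniform_boundary (a b : R) : (forall x : R, a <= x <= b -> x != 0) ->
  exists2 d : R, 0 < d & forall y x : R, 0 < y -> y < d -> a <= x <= b ->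
    `|Im (stieltjes mu (Complex x y)) - Im (Fb x)| < 1.
Proof.
move=> ab0.
have /compact_near_coveringP cov := @segment_compact R a b.
have := cov _ (0^'+ : set_system R) (fun y x => `|Im (stieltjes mu (Complex x y)) - Im (Fb x)| < 1) _.
have F0 : Filter (0^'+ : set_system R) by exact: at_right_proper_filter.
move=> /(_ F0).
have cvr x : `[a, b]%classic x -> \forall x' \near x & y \near (0 : R)^'+,
    `|Im (stieltjes mu (Complex x' y)) - Im (Fb x')| < 1.
  rewrite /= in_itv /= => xab; have x0 := ab0 x xab.
  have h20 : 0 < 2^-1 :> R by rewrite invr_gt0.
  have [d1 d10 h1] := Fb_lim x0 h20.
  have [d2 d20 h2] := boundary_value_close x0 h20.
  have x00 : 0 < `|x| by rewrite normr_gt0.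
  pose dd := Num.min (d1 / 2) (Num.min d2 `|x|).
  have dd0 : 0 < dd by rewrite !lt_min divr_gt0// d20.
  exists ([set x' | `|x - x'| < dd], [set y | 0 < y < d1 / 2]).
    split => /=.
      by apply/nbhs_ballP; exists dd.
    near=> y; apply/andP; split; near: y; first exact: nbhs_right_gt.
    by apply: nbhs_right_lt; rewrite divr_gt0.
  move=> [x' y] [/=]; rewrite !lt_min => /and3P[xx1 xx2 xx3] /andP[y0 y1].
  have x'0 : x' != 0 by apply/negP => /eqP e1; move: xx3; rewrite e1 subr0 ltxx.
  have k1 : cabs (stieltjes mu (Complex x' y) - Fb x) < 2^-1.
    apply: h1 => //; rewrite (le_lt_trans (cabs_Complex _ _ _))// distrC (gtr0_norm y0).
    by rewrite [ltRHS](splitr d1) ltrD.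
  have k2 : cabs (Fb x' - Fb x) <= 2^-1 by apply: h2; rewrite // distrC.
  rewrite -[X in `|X|]/(Im (stieltjes mu (Complex x' y)) - Im (Fb x')).
  rewrite -ImN -ImD; apply: le_lt_trans (Im_le_cabs _) _.
  have := cabsD (stieltjes mu (Complex x' y) - Fb x) (- (Fb x' - Fb x)).
  rewrite cabsN opprB addrA subrK; lra.
move=> /(_ cvr) /nbhs_ballP[d /= d0 h]; exists d => // y x y0 yd xab.
by apply: (h y) => //; rewrite ?in_itv// /ball /= sub0r normrN gtr0_norm.
Unshelve. all: by end_near. Qed.

Lemma poisson_int_ge0 (a b y t : R) : a < b -> 0 < y -> 0 <= poisson_int a b y t.
Proof.
move=> ab y0; rewrite subr_ge0 ltW// lt_atan// ltr_pM2r ?invr_gt0//.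
by rewrite ltrD2r.
Qed.

(** A domination uniform in [0 < y <= 1]. For [t < 1 + 2 |b|] the angle is at most [pi]. For larger
    [t], [t - x >= (1 + t) / 2] on the segment, so the kernel is at most [4 / (1 + t)] over a length
    [b - a]. *)
Lemma poisson_int_le_inv (a b y t : R) : a < b -> 0 < y -> y <= 1 -> 0 <= t ->
  poisson_int a b y t <= (pi * (2 + 2 * `|b|) + 4 * (b - a)) * (1 + t)^-1.
Proof.
move=> ab y0 y1 t0; have t1 : 0 < 1 + t by rewrite ltr_pwDl.
have p0 : 0 < pi :> R := pi_gt0 R; have b0 := normr_ge0 b; have bb := ler_norm b.
have [tT|Tt] := ltP t (1 + 2 * `|b|).
  rewrite ler_pdivlMr//.
  have k1 : poisson_int a b y t <= pi.
    by have := atan_ltpi2 ((b - t) / y); have := atan_gtNpi2 ((a - t) / y); rewrite /poisson_int; lra.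
  have k2 : poisson_int a b y t * (1 + t) <= pi * (2 + 2 * `|b|).
    by rewrite ler_pM ?poisson_int_ge0// ?(ltW t1)//; lra.
  by rewrite (le_trans k2)// lerDl mulr_ge0// subr_ge0 ltW.
apply: (@le_trans _ _ (4 * (b - a) * (1 + t)^-1)); last first.
  by rewrite ler_wpM2r ?invr_ge0 ?(ltW t1)// lerDr mulr_ge0 ?(ltW p0)//; lra.
rewrite -lee_fin -integral_poisson//.
apply: (@le_trans _ _ (\int[leb]_(x in `[a, b]) (cst (4 / (1 + t))%:E) x)%E); last first.
  rewrite integral_cst//= lebesgue_measure_itv/= lte_fin ab -EFinB -EFinM lee_fin.
  by rewrite mulrAC.
apply: ge0_le_integral => //.
- by move=> x _; rewrite lee_fin poisson_ge0.
- apply/measurable_EFinP; apply: measurable_funTS.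
  by apply: (measurable_poisson_comp (f := fun x : R => t - x)) => //; exact: measurable_funB.
- move=> x /=; rewrite in_itv /= => /andP[_ xb]; rewrite lee_fin.
  have tx : (1 + t) / 2 <= t - x by lra.
  have d0 := poisson_den_gt0 t x y0.
  rewrite /poisson ler_pdivrMr// mulrAC ler_pdivlMr//.
  have q : ((1 + t) / 2) ^+ 2 <= (t - x) ^+ 2.
    by rewrite ler_pXn2r// nnegrE ?divr_ge0 ?(ltW t1)// (le_trans _ tx)// divr_ge0// ltW.
  apply: (@le_trans _ _ (1 * (1 + t))); first by rewrite ler_pM2r.
  have : 1 + t <= (1 + t) ^+ 2 by rewrite expr2 ler_peMl ?(ltW t1)// lerDl.
  have := sqr_ge0 y; move: q; rewrite expr_div_n; move: ((t - x) ^+ 2) ((1 + t) ^+ 2) (y ^+ 2) => A B C; lra.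
Qed.

Lemma measurable_poisson_pair (y : R) : 0 < y ->
  measurable_fun setT (fun p : R * R => poisson y p.2 p.1).
Proof.
move=> y0; apply: (measurable_poisson_comp (f := fun p : R * R => p.2 - p.1)) => //.
exact: measurable_funB.
Qed.

Lemma integral_poisson_t (x y : R) : 0 < y ->
  (\int[mu]_t (poisson y t x)%:E = (Im (stieltjes mu (Complex x y)))%:E)%E.
Proof.
move=> y0; rewrite Im_stieltjesE// integral_Rplus//.
- by apply/measurable_EFinP; exact: measurable_poisson_t.
- by move=> t; rewrite lee_fin poisson_ge0.
Qed.

Lemma measurable_Im_stieltjes (y : R) : 0 < y ->
  measurable_fun setT (fun x => Im (stieltjes mu (Complex x y))).
Proof.
move=> y0; apply/measurable_EFinP.
have [||] := @tonelli_lebesgue _ mu (fun p : R * R => (poisson y p.2 p.1)%:E) mu_sigma_finite.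
- by apply/measurable_EFinP; exact: measurable_poisson_pair.
- by move=> p; rewrite lee_fin poisson_ge0.
by under eq_fun do rewrite /= integral_poisson_t//.
Qed.

Lemma integral_Im_stieltjes (a b y : R) : a < b -> 0 < y ->
  (\int[leb]_(x in `[a, b]) (Im (stieltjes mu (Complex x y)))%:E =
   \int[mu]_(t in Rplus R) (poisson_int a b y t)%:E)%E.
Proof.
move=> ab y0.
pose f (p : R * R) := (\1_`[a, b]%classic p.1 * poisson y p.2 p.1)%:E.
have mf : measurable_fun setT f.
  apply/measurable_EFinP; apply: measurable_funM; last exact: measurable_poisson_pair.
  by apply: measurableT_comp => //; exact: measurable_indic.
have f0 p : (0 <= f p)%E.
  by rewrite lee_fin mulr_ge0 ?poisson_ge0// indicE ler0n.
have [mI] := tonelli_lebesgue mu_sigma_finite mf f0.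
have -> : (\int[leb]_x \int[mu]_t f (x, t) =
           \int[leb]_(x in `[a, b]) (Im (stieltjes mu (Complex x y)))%:E)%E.
  rewrite [RHS]integral_mkcond; apply: eq_integral => x _.
  rewrite patchE; under eq_integral do rewrite [f _]EFinM.
  rewrite /= ge0_integralZl//=; last 2 first.
  - by apply/measurable_EFinP; exact: measurable_poisson_t.
  - by move=> t _; rewrite lee_fin poisson_ge0.
  by rewrite integral_poisson_t// indicE; case: ifPn => _; rewrite ?mul1e ?mul0e.
move=> ->.
have -> : (fun t => \int[leb]_x f (x, t))%E = (fun t => (poisson_int a b y t)%:E).
  apply/funext => t; rewrite -integral_poisson// [RHS]integral_mkcond.
  apply: eq_integral => x _; rewrite patchE /f /= indicE.
  by case: ifPn => _; rewrite ?mul1r ?mul0r.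
rewrite integral_Rplus//; last by move=> t; rewrite lee_fin poisson_int_ge0.
by apply/measurable_EFinP; exact: measurable_poisson_int.
Qed.

Lemma cvg_atan_scaled (d u : R) : 0 < d -> 0 < u ->
  atan (u / (d / n.+1%:R)) @[n --> \oo] --> pi / 2.
Proof.
move=> d0 u0.
have h : u / (d / n.+1%:R) @[n --> \oo] --> +oo.
  apply/cvgryPge => M; near=> n.
  have -> : u / (d / n.+1%:R) = u / d * n.+1%:R by rewrite invfM invrK mulrA.
  rewrite mulrC -ler_pdivrMr ?divr_gt0//.
  apply: (@le_trans _ _ n%:R); last by rewrite ler_nat.
  by near: n; exact: nbhs_infty_ger.
exact: cvg_comp h (@cvgy_atan R).
Unshelve. all: by end_near. Qed.

(** The two arctangents tend to opposite values of [pi / 2] inside and to equal ones outside. At an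
    endpoint the limit would be [pi / 2], hence the exclusion. *)
Lemma cvg_poisson_int (a b d t : R) : 0 < d -> a < b -> t != a -> t != b ->
  poisson_int a b (d / n.+1%:R) t @[n --> \oo] --> pi * \1_`]a, b[%classic t.
Proof.
move=> d0 ab ta tb.
have pos (u : R) : t < u -> atan ((u - t) / (d / n.+1%:R)) @[n --> \oo] --> pi / 2.
  by move=> tu; apply: cvg_atan_scaled => //; rewrite subr_gt0.
have neg (u : R) : u < t -> atan ((u - t) / (d / n.+1%:R)) @[n --> \oo] --> - (pi / 2).
  move=> ut; have -> : (fun n : nat => atan ((u - t) / (d / n.+1%:R))) =
      (fun n : nat => - atan ((t - u) / (d / n.+1%:R))).
    by apply/funext => n; rewrite -atanN -mulNr opprB.
  by apply: cvgN; apply: cvg_atan_scaled => //; rewrite subr_gt0.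
rewrite /poisson_int indicE; case: (ltgtP t a) ta => // [lta|gta] _.
  have tb' := lt_trans lta ab.
  rewrite memNset; last by rewrite /= in_itv /= ltNge (ltW lta).
  rewrite mulr0 -(subrr (pi / 2)); apply: cvgB; exact: pos.
case: (ltgtP t b) tb => // [ltb|gtb] _.
  rewrite mem_set; last by rewrite /= in_itv /= gta.
  rewrite (_ : pi * _ = pi / 2 - - (pi / 2)); last by rewrite mulr1 opprK -splitr.
  by apply: cvgB; [exact: pos|exact: neg].
rewrite memNset; last by rewrite /= in_itv /= [t < b]ltNge (ltW gtb) andbF.
rewrite mulr0 -(subrr (- (pi / 2))); apply: cvgB; exact: neg.
Qed.

(** Let [y] tend to 0 on both sides of [integral_Im_stieltjes]. The Lebesgue side is dominated by
    [|Im Fb| + 1], the [mu] side by a multiple of [1 / (1 + t)]; convergence on the [mu] side fails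
    at most at the endpoints, which [no_atom] makes null. *)
Lemma stieltjes_inversion (a b : R) : a < b -> (forall x : R, a <= x <= b -> x != 0) ->
  (\int[leb]_(x in `[a, b]) (Im (Fb x))%:E = pi%:E * mu `]a, b[%classic)%E.
Proof.
move=> ab ab0.
have [d' d'0 hd] := uniform_boundary ab0.
(* Half of [d'] keeps the sequence strictly inside the uniform range; the cap 1 is required by
   [poisson_int_le_inv]. *)
pose d := Num.min (d' / 2) 1.
have d0 : 0 < d by rewrite lt_min divr_gt0//= ltr01.
pose y_ (n : nat) : R := d / n.+1%:R.
have y0 n : 0 < y_ n by rewrite divr_gt0// ltr0n.
have yd n : y_ n <= d by rewrite ler_pdivrMr ?ltr0n// ler_peMr ?(ltW d0)// ler1n.
have yd' n : y_ n < d'.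
  apply: le_lt_trans (yd n) _; rewrite (@le_lt_trans _ _ (d' / 2))// ?ge_min ?lexx//.
  by rewrite ltr_pdivrMr// ltr_pMr// ltr1n.
have y1 n : y_ n <= 1 by apply: le_trans (yd n) _; rewrite ge_min lexx orbT.
have ycvg : y_ n @[n --> \oo] --> (0 : R).
  rewrite -[X in _ --> X](mulr0 d); apply: cvgM; first exact: cvg_cst.
  exact: cvg_harmonic.
have cFb : {within `[a, b], continuous (fun x => Im (Fb x))}.
  apply: continuous_in_subspaceT => x /set_mem /=; rewrite in_itv /= => /ab0.
  exact: boundary_Im_continuous.
have iFb : leb.-integrable `[a, b] (EFin \o (fun x => Im (Fb x))).
  by apply: continuous_compact_integrable => //; exact: segment_compact.
have ig : leb.-integrable `[a, b] (EFin \o (fun x => `|Im (Fb x)| + 1)).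
  apply: continuous_compact_integrable; first exact: segment_compact.
  apply: continuous_in_subspaceT => x /set_mem /=; rewrite in_itv /= => /ab0 x0.
  apply: cvgD; last exact: cvg_cst.
  by apply: cvg_norm; exact: boundary_Im_continuous.
have [|||||_ _ L1] := @dominated_convergence _ _ _ leb `[a, b]%classic (measurable_itv _)
    (fun n x => (Im (stieltjes mu (Complex x (y_ n))))%:E)
    (fun x => (Im (Fb x))%:E) (EFin \o (fun x => `|Im (Fb x)| + 1)).
- move=> n; apply/measurable_EFinP; apply: measurable_funTS.
  exact: measurable_Im_stieltjes.
- by have /integrableP[] := iFb.
- apply: aeW => x /=; rewrite in_itv /= => xab; apply: cvg_EFin; first exact: nearW.
  apply/cvgrPdist_lt => e e0; have [r r0 hr] := Fb_lim (ab0 x xab) e0.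
  have /cvgrPdist_lt/(_ _ r0) := ycvg; apply: filterS => n.
  rewrite sub0r normrN => yr.
  rewrite -[X in `|X| < _]/(Im (Fb x) - Im (stieltjes mu (Complex x (y_ n)))) distrC -ImN -ImD.
  apply: le_lt_trans (Im_le_cabs _) _; apply: hr => //.
    exact: y0.
  by rewrite (le_lt_trans (cabs_Complex _ _ _))// subrr normr0 add0r.
- exact: ig.
- apply: aeW => x n /=; rewrite in_itv /= => xab; rewrite lee_fin.
  have := hd (y_ n) x (y0 n) (yd' n) xab.
  rewrite -[X in _ -> `|X| <= _]/(Im (stieltjes mu (Complex x (y_ n)))).
  move: (Im (stieltjes _ _)) (Im (Fb x)) => u v /ltW h.
  by rewrite -(subrK v u) (le_trans (ler_normD _ _))// addrC lerD2l.
pose C := pi * (2 + 2 * `|b|) + 4 * (b - a).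
have mK n := measurable_poisson_int a b (y_ n).
have [|||||_ _ L2] := @dominated_convergence _ _ _ mu (Rplus R) mRp
    (fun n t => (poisson_int a b (y_ n) t)%:E)
    (fun t => (pi * \1_`]a, b[%classic t)%:E) (fun t => C%:E * ((1 + t)^-1)%:E)%E.
- by move=> n; apply/measurable_EFinP; apply: measurable_funTS.
- apply/measurable_EFinP; apply: measurable_funTS; exact: measurable_funM.
- have neg0 : mu ([set a] `|` [set b]) = 0%E.
    apply/eqP; rewrite eq_le measure_ge0 andbT.
    rewrite (le_trans (measureU2 _ _ _))//.
    rewrite [X in (X + _)%E](_ : _ = 0%E); last by apply: no_atom; rewrite ab0// lexx ltW.
    by rewrite [X in (_ + X)%E](_ : _ = 0%E) ?adde0//; apply: no_atom; rewrite ab0// lexx ltW.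
  exists ([set a] `|` [set b]); split => //; first exact: measurableU.
  move=> t /=; apply: contra_notP => /not_orP[/eqP ta /eqP tb] _.
  by apply: cvg_EFin; [exact: nearW|exact: cvg_poisson_int].
- by apply: integrableZl => //; exact: integrable_inv1D.
- apply: aeW => t n t0; rewrite -EFinM lee_fin ger0_norm ?poisson_int_ge0//.
  exact: poisson_int_le_inv.
have L12 : (\int[leb]_(x in `[a, b]) (Im (Fb x))%:E =
    \int[mu]_(t in Rplus R) (pi * \1_`]a, b[%classic t)%:E)%E.
  apply: (cvg_unique _ L1); first exact: ereal_hausdorff.
  have seqE : (fun n => \int[leb]_(x in `[a, b]) (Im (stieltjes mu (Complex x (y_ n))))%:E)%E =
      (fun n => \int[mu]_(t in Rplus R) (poisson_int a b (y_ n) t)%:E)%E.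
    by apply/funext => n; exact: integral_Im_stieltjes.
  by rewrite [X in X @ _](_ : _ = (fun n => \int[mu]_(t in Rplus R) (poisson_int a b (y_ n) t)%:E)%E).
rewrite L12 integral_Rplus; last 2 first.
- apply/measurable_EFinP; exact: measurable_funM.
- by move=> t; rewrite lee_fin mulr_ge0 ?pi_ge0// indicE ler0n.
under eq_integral do rewrite EFinM.
rewrite ge0_integralZl//; last by rewrite lee_fin pi_ge0.
- by rewrite integral_indic// setIT.
- by apply/measurable_EFinP; exact: measurable_indic.
Qed.

Let g (x : R) : \bar R := (Im (Fb x) / pi)%:E.

Let g_ge0 (x : R) : x != 0 -> (0 <= g x)%E.
Proof. by move=> x0; rewrite lee_fin divr_ge0 ?pi_ge0// boundary_Im_ge0. Qed.

Let open_neq0 : open [set x : R | x != 0].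
Proof. exact: open_neq. Qed.

Let measurable_ImFb (D : set R) : (forall x, D x -> x != 0) ->
  measurable_fun D (fun x => Im (Fb x)).
Proof.
move=> D0; apply: (@measurable_funS _ _ _ _ [set x : R | x != 0]) => //.
  exact: open_measurable.
apply: open_continuous_measurable_fun => // x /set_mem.
exact: boundary_Im_continuous.
Qed.

Let measurable_g (D : set R) : (forall x, D x -> x != 0) -> measurable_fun D g.
Proof.
move=> D0; apply/measurable_EFinP; apply: measurable_funM; last exact: measurable_cst.
exact: measurable_ImFb.
Qed.

Lemma density_itv (a b : R) : (forall x : R, a <= x <= b -> x != 0) ->
  mu `]a, b[%classic = (\int[leb]_(x in `]a, b[) g x)%E.
Proof.
move=> ab0; have [ab|ba] := ltP a b; last first.
  by rewrite set_itv_ge ?measure0 ?integral_set0// bnd_simp -leNgt.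
have D0 (x : R) : `[a, b]%classic x -> x != 0 by rewrite /= in_itv /=; exact: ab0.
have sub (x : R) : `]a, b[%classic x -> x != 0.
  by move=> h; apply: D0; move: h; exact: subset_itv_oo_cc.
rewrite -(@integral_itv_bndoo _ _ _ _ true false); last exact: measurable_g.
have := stieltjes_inversion ab ab0.
have -> : (\int[leb]_(x in `[a, b]) g x =
    \int[leb]_(x in `[a, b]) (pi^-1%:E * (Im (Fb x))%:E))%E.
  by apply: eq_integral => x _; rewrite /g mulrC.
rewrite ge0_integralZl//; last 3 first.
- by apply/measurable_EFinP; exact: measurable_ImFb.
- by move=> x /D0 x0; rewrite lee_fin boundary_Im_ge0.
- by rewrite lee_fin invr_ge0 pi_ge0.
move=> ->; rewrite muleA -EFinM mulVf ?gt_eqF ?pi_gt0//.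
by rewrite mul1e.
Qed.

(** Restricted to []p, q[], [mu] is finite and the density is nonnegative everywhere, so both sides
    are measures in [A]. They agree on open intervals, which are stable under intersection and
    generate the Borel sets. *)
Lemma density_restr (p q : R) (A : set R) : (forall x : R, p <= x <= q -> x != 0) ->
  measurable A ->
  mu (A `&` `]p, q[%classic) = (\int[leb]_(x in A `&` `]p, q[%classic) g x)%E.
Proof.
move=> pq0 mA.
pose D := `]p, q[%classic : set R.
have mD : measurable D by exact: measurable_itv.
have D0 (x : R) : D x -> x != 0.
  by rewrite /D /= in_itv /= => /andP[? ?]; apply: pq0; rewrite !ltW.
pose gD := g \_ D.
have mgD : measurable_fun setT gD.
  by apply/measurable_restrict => //; rewrite setTI; exact: measurable_g.
have gD0 x : (0 <= gD x)%E.
  by rewrite /gD patchE; case: ifPn => // /set_mem /D0; exact: g_ge0.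
pose m2 (B : set R) : \bar R := (\int[leb]_(x in B) gD x)%E.
have m20 : m2 set0 = 0%E by rewrite /m2 integral_set0.
have m2ge0 B : (0 <= m2 B)%E by exact: integral_ge0.
have m2s : semi_sigma_additive m2.
  by have := @semi_sigma_additive_nng_induced _ _ R leb gD mgD gD0.
pose H := isMeasure.Build _ _ _ m2 m20 m2ge0 m2s.
pose M2 : {measure set R -> \bar R} := HB.pack m2 H.
have := @measure_unique _ R _ (@RGenOpens.G R) (fun n => `](- n%:R), n%:R[%classic)
  (@RGenOpens.measurableE R) _ _ _ (mrestr mu mD) M2 _ _ A mA.
rewrite /= /mrestr [m2 A]/(m2 A) /m2 -integral_mkcondr; apply.
- move=> _ _ [a [b ->]] [a' [b' ->]]; exists (Num.max a a'), (Num.min b b').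
  exact: setI_itvoo.
- by move=> n; exists (- n%:R), n%:R.
- apply/seteqP; split=> // t _; exists (Num.trunc `|t|).+1 => //=.
  by rewrite in_itv /= -ltr_norml truncnS_gt.
- move=> _ [a [b ->]] /=.
  have e : `]a, b[%classic `&` D = `]Num.max a p, Num.min b q[%classic by exact: setI_itvoo.
  rewrite /mrestr /m2 /= -integral_mkcondr e; apply: density_itv => x /andP[].
  by rewrite ge_max le_min => /andP[_ ?] /andP[_ ?]; apply: pq0; apply/andP.
- move=> n; rewrite /mrestr; apply: le_lt_trans (mu_fin p q).
  rewrite le_measure// ?inE//; first exact: measurableI.
  by apply: subIset; right; exact: subset_itv_oo_cc.
Qed.

(** Continuity from below of [mu] against monotone convergence of the integral, along an increasing
    sequence of intervals. *)
Lemma density_bigcup (p q : nat -> R) (A : set R) :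
  (forall n x, p n <= x <= q n -> x != 0) ->
  (forall m n, (m <= n)%N -> p n <= p m) -> (forall m n, (m <= n)%N -> q m <= q n) ->
  measurable A ->
  mu (\bigcup_n (A `&` `]p n, q n[%classic)) =
  (\int[leb]_(x in \bigcup_n (A `&` `]p n, q n[%classic)) g x)%E.
Proof.
move=> pq0 np nq mA; pose F n := A `&` `]p n, q n[%classic.
have mF n : measurable (F n) by apply: measurableI => //; exact: measurable_itv.
have nF : nondecreasing_seq F.
  move=> m n mn; apply/subsetPset => x [Ax]; rewrite /= !in_itv /= => /andP[h1 h2].
  by split=> //=; rewrite in_itv /= (le_lt_trans (np _ _ mn))// (lt_le_trans h2 (nq _ _ mn)).
have F0 n x : F n x -> x != 0.
  by move=> [_]; rewrite /= in_itv /= => /andP[h1 h2]; apply: (pq0 n); rewrite !ltW.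
have L1 := nondecreasing_cvg_mu mF (bigcupT_measurable _ mF) nF (mu := mu).
have L2 : (\int[leb]_(x in F n) g x)%E @[n --> \oo] --> (\int[leb]_(x in \bigcup_n F n) g x)%E.
  apply: ge0_nondecreasing_set_cvg_integral => //.
  - by move=> n; apply: measurable_g; exact: F0.
  - by move=> n x /F0; exact: g_ge0.
apply: (cvg_unique _ L1); first exact: ereal_hausdorff.
have -> : mu \o F = (fun n => \int[leb]_(x in F n) g x)%E => //.
by apply/funext => n /=; apply: density_restr => //; exact: pq0.
Qed.

Lemma stieltjes_density : density_on_Rstar mu (fun x => Im (Fb x) / pi).
Proof.
move=> A mA A0; rewrite -/g.
have posP := @density_bigcup (fun n => n.+1%:R^-1) (fun n => n.+1%:R) A.
have negP := @density_bigcup (fun n => - n.+1%:R) (fun n => - n.+1%:R^-1) A.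
set P := \bigcup_n (A `&` `]n.+1%:R^-1, n.+1%:R[%classic) in posP.
set N := \bigcup_n (A `&` `](- n.+1%:R), (- n.+1%:R^-1)[%classic) in negP.
have i0 n : 0 < n.+1%:R^-1 :> R by rewrite invr_gt0 ltr0n.
have mono m n : (m <= n)%N -> n.+1%:R^-1 <= m.+1%:R^-1 :> R.
  by move=> mn; rewrite lef_pV2 ?posrE ?ltr0n// ler_nat.
have P1 : mu P = (\int[leb]_(x in P) g x)%E.
  apply: posP => //; last by move=> m n mn; rewrite ler_nat.
  by move=> n x /andP[h _]; rewrite gt_eqF// (lt_le_trans (i0 n)).
have N1 : mu N = (\int[leb]_(x in N) g x)%E.
  apply: negP => //.
  - by move=> n x /andP[_ h]; rewrite lt_eqF// (le_lt_trans h)// oppr_lt0.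
  - by move=> m n mn; rewrite lerN2 ler_nat.
  - by move=> m n mn; rewrite lerN2 mono.
have big (x : R) : 0 < x -> exists n, n.+1%:R^-1 < x < n.+1%:R.
  (* The resulting integer [n + 1] exceeds [x + 1 / x], hence both [x] and [1 / x]. *)
  move=> x0; exists (Num.trunc (x + x^-1)).
  have := truncnS_gt (x + x^-1); set n := _.+1%:R => h.
  have ix : 0 < x^-1 by rewrite invr_gt0.
  have n0 : 0 < n by rewrite ltr0n.
  rewrite (lt_trans _ h) ?ltrDl// andbT -[ltRHS]invrK ltf_pV2 ?posrE//.
  by rewrite (lt_trans _ h)// ltrDr.
have AE : A = P `|` N.
  apply/seteqP; split=> [x Ax|x [|] [n _ []]//].
  have := A0 x Ax; rewrite /Rstar /= neq_lt => /orP[xn|xp].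
    right; have [|n hn] := big (- x); first by rewrite oppr_gt0.
    by exists n => //; split=> //=; rewrite in_itv /= ltrNl andbC ltrNr.
  by left; have [n hn] := big x xp; exists n => //; split=> //=; rewrite in_itv /=.
have PN0 : P `&` N = set0.
  apply/seteqP; split=> // x [[n _ [_ hn]] [m _ [_ hm]]]; move: hn hm; rewrite /= !in_itv /= => /andP[h1 _] /andP[_ h2].
  have := lt_trans (i0 n) h1; have := lt_trans h2 (_ : - m.+1%:R^-1 < 0).
  by rewrite oppr_lt0 => /(_ (i0 m)) /lt_trans h /h; rewrite ltxx.
have mP : measurable P.
  by apply: bigcupT_measurable => n; apply: measurableI => //; exact: measurable_itv.
have mN : measurable N.
  by apply: bigcupT_measurable => n; apply: measurableI => //; exact: measurable_itv.
rewrite AE measureU// ge0_integral_setU//; last 3 first.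
- by apply: measurable_g => x; rewrite -AE; exact: A0.
- by move=> x; rewrite -AE => /A0; exact: g_ge0.
- exact/disj_set2P.
by rewrite -P1 -N1.
Qed.

End StieltjesInversion.

(** * Boundary densities and comparison of supports *)

Section BoundaryDensities.
Context {R : realType}.
Local Notation Re := complex.Re.
Local Notation Im := complex.Im.
Local Notation leb := (@lebesgue_measure R).

Lemma near_Cplus_nbhs (x r : R) : 0 < r ->
  \forall z \near Cplus_nbhs x, Cplus z /\ cabs (z - x%:C) < r.
Proof. by move=> r0; exists r. Qed.

Lemma ccvg_Cplus_id (x : R) : ccvg (Cplus_nbhs x) id x%:C.
Proof.
have PF := Cplus_nbhs_proper x.
by apply: ccvg_to_real => r /(near_Cplus_nbhs x); apply: filterS => z [].
Qed.

Lemma lim_Cplus_ext (f g : R[i] -> R[i]) (x : R) (l : R[i]) :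
  (forall z, Cplus z -> f z = g z) -> lim_Cplus f x l -> lim_Cplus g x l.
Proof.
move=> fg fl e /fl[r r0 h]; exists r => // z z0 zr.
by rewrite -fg//; exact: h.
Qed.

(** The limit of [Im (z * d) = gam * Im dt] with [gam >= kap2]. Thus [Im D = 0] forces [Im Dt = 0],
    and the twin gives the converse; for [x < 0] the bound alone forces [Im Dt = 0]. *)
Lemma boundary_Im_bounds c ct nu nut d dt (x : R) (D Dt : R[i]) :
  coupled_system c ct nu nut d dt -> x != 0 ->
  lim_Cplus d x D -> lim_Cplus dt x Dt ->
  [/\ 0 <= Im D, 0 <= Im Dt & exists2 k, 0 < k & k * Im Dt <= x * Im D].
Proof.
move=> S x0 /lim_CplusP cD /lim_CplusP cDt.
have PF := Cplus_nbhs_proper x; have cz := ccvg_Cplus_id x.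
have r0 : 0 < `|x| / 2 by rewrite divr_gt0// normr_gt0.
have x4 : 0 < x ^+ 2 / 4 by rewrite divr_gt0// exprn_even_gt0.
have [K KP] := coupled_system_bounded (coupled_system_sym S) x4.
pose L := 1 + `|K|; have L1 : 1 <= L by rewrite lerDl.
have near0 := near_Cplus_nbhs x r0.
split.
- apply: (cvg_near_le PF (cvg_cst 0) cD.2).
  by apply: filterS near0 => z [z0 _]; exact: ltW (sys_d S z0).
- apply: (cvg_near_le PF (cvg_cst 0) cDt.2).
  by apply: filterS near0 => z [z0 _]; exact: ltW (sys_dt S z0).
exists (kap2 nu c L).
  by apply: kap2_gt0 => //; [exact: sys_nu S|exact: sys_nu0 S|exact: sys_c S].
have -> : x * Im D = Im (x%:C * D) by rewrite !partsE mul0r addr0.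
have l1 : kap2 nu c L * Im (dt z) @[z --> Cplus_nbhs x] --> kap2 nu c L * Im Dt.
  by apply: cvgM; [exact: cvg_cst|exact: cDt.2].
apply: (cvg_near_le PF l1 (ccvgM PF cz cD).2).
apply: filterS near0 => z [z0 /nrm2_near_real/andP[zx _]].
rewrite (Im_zd S z0) ler_wpM2r//; first exact: ltW (sys_dt S z0).
apply: gam_ge_kap2 => //; [exact: sys_c S|exact: sys_dt S _ z0|].
by rewrite (le_trans (KP _ z0 zx))// /L (le_trans (ler_norm K))// lerDr.
Qed.

Lemma m_transform_rker (nu : probability R R) (dt : R[i] -> R[i]) (z : R[i]) :
  Cplus z -> Cplus (dt z) -> z * m_transform nu dt z = - cint nu (rker (dt z)).
Proof.
move=> z0 dt0; have zn := Cplus_neq0 z0.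
rewrite /m_transform (@eq_cint _ nu _ (fun t => (- z)^-1 * rker (dt z) t)); last first.
  by move=> t _; rewrite invfM.
rewrite cintZ; last exact: cbmeas_rker.
by rewrite mulrA invrN mulrN divff// mulN1r.
Qed.

(** Replace [rker] by [1 - dt * uker dt] in [z * m], then eliminate the integral of [uker] by the
    first equation. *)
Lemma m_transform_eq c ct nu nut d dt (z : R[i]) :
  coupled_system c ct nu nut d dt -> Cplus z ->
  m_transform nu dt z = - z^-1 - d z * dt z * c^-1%:C.
Proof.
move=> S z0; have zn := Cplus_neq0 z0; have dt0 := sys_dt S z0.
have cn : c%:C != 0 :> R[i] by rewrite eq_complex /= negb_and gt_eqF ?(sys_c S).
apply: (@mulfI _ z) => //; rewrite m_transform_rker//.
rewrite (@eq_cint _ nu _ (fun t => 1 + - (dt z * uker (dt z) t))); last first.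
  by move=> t _; rewrite uker_rker// opprB addrCA subrr addr0.
have cu := cbmeas_uker dt0.
have cdu : cbmeas (fun t => dt z * uker (dt z) t).
  by apply: cbmeasM => //; exact: cbmeas_cst.
rewrite cintD; [|exact: cbmeas_cst|exact: cbmeasN].
rewrite cintN// cintZ// (cint_cst (sys_nu S)).
have -> : cint nu (uker (dt z)) = c^-1%:C * (- z * d z).
  by rewrite (sys_eq S z0) mulrA -rmorphM /= mulVf ?mul1r// gt_eqF ?(sys_c S).
rewrite mulrBr mulrN divff//; ring.
Qed.

Lemma m_transform_limit c ct nu nut d dt (x : R) (D Dt : R[i]) :
  coupled_system c ct nu nut d dt -> x != 0 ->
  lim_Cplus d x D -> lim_Cplus dt x Dt ->
  lim_Cplus (m_transform nu dt) x (- (x%:C)^-1 - D * Dt * c^-1%:C).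
Proof.
move=> S x0 /lim_CplusP cD /lim_CplusP cDt.
have PF := Cplus_nbhs_proper x; have cz := ccvg_Cplus_id x.
apply: (@lim_Cplus_ext (fun z => - z^-1 - d z * dt z * c^-1%:C)).
  by move=> z z0; rewrite (m_transform_eq S z0).
apply/lim_CplusP; apply: (ccvgD PF); last first.
  by apply: (ccvgN PF); apply: (ccvgM PF); [exact: (ccvgM PF)|exact: (ccvg_cst PF)].
apply: (ccvgN PF).
have nx : nrm2 x%:C != 0 :> R by rewrite nrm2C sqrf_eq0.
have cn := cvg_nrm2 PF cz.
have cni : (nrm2 z)^-1 @[z --> Cplus_nbhs x] --> (nrm2 x%:C)^-1 by apply: cvgV.
split.
- under eq_fun do rewrite ReV; rewrite ReV.
  by apply: cvgM => //; exact: cz.1.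
- under eq_fun do rewrite ImV; rewrite ImV.
  by apply: cvgN; apply: cvgM => //; exact: cz.2.
Qed.

(** The formula for [m] through [d * dt] shows no sign. Instead [Im (z * m)] is [Im dt] times the
    mean of [t |rker|^2], which is at least [kap1]; that integrand is written as
    [Re (conj(rker) * uker)], a product of bounded functions. *)
Lemma boundary_Im_m_bound c ct nu nut d dt (x : R) (Dt M : R[i]) :
  coupled_system c ct nu nut d dt -> x != 0 ->
  lim_Cplus dt x Dt -> lim_Cplus (m_transform nu dt) x M ->
  exists2 k, 0 < k & k * Im Dt <= x * Im M.
Proof.
move=> S x0 /lim_CplusP cDt /lim_CplusP cM.
have PF := Cplus_nbhs_proper x; have cz := ccvg_Cplus_id x.
have r0 : 0 < `|x| / 2 by rewrite divr_gt0// normr_gt0.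
have x4 : 0 < x ^+ 2 / 4 by rewrite divr_gt0// exprn_even_gt0.
have [K KP] := coupled_system_bounded (coupled_system_sym S) x4.
pose L := 1 + `|K|; have L1 : 1 <= L by rewrite lerDl.
exists (kap1 nu L); first by apply: kap1_gt0 => //; [exact: sys_nu S|exact: sys_nu0 S].
have -> : x * Im M = Im (x%:C * M) by rewrite !partsE mul0r addr0.
have l1 : kap1 nu L * Im (dt z) @[z --> Cplus_nbhs x] --> kap1 nu L * Im Dt.
  by apply: cvgM; [exact: cvg_cst|exact: cDt.2].
apply: (cvg_near_le PF l1 (ccvgM PF cz cM).2).
apply: filterS (near_Cplus_nbhs x r0) => z [z0 /nrm2_near_real/andP[zx _]].
have dt0 := sys_dt S z0.
have cru : cbmeas (fun t => conjc (rker (dt z) t) * uker (dt z) t).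
  by apply: cbmeasM; [exact/cbmeasJ/cbmeas_rker|exact: cbmeas_uker].
have := cbmeas_rker dt0 => -[_ bI].
rewrite /= m_transform_rker// ImN /= -/(Ex nu _) -ExN//.
rewrite (@eq_Ex _ nu _ (fun t => Im (dt z) * Re (conjc (rker (dt z) t) * uker (dt z) t))); last first.
  move=> t _; rewrite ukerE.
  have -> : Im (rker (dt z) t) = - (Im (dt z) * t * nrm2 (rker (dt z) t)).
    by rewrite /rker nrm2V ImV !partsE; ring.
  by rewrite /nrm2 !partsE; ring.
rewrite ExZ; last by case: cru.
rewrite mulrC ler_wpM2l//; first exact: ltW dt0.
apply: Ex_tr_ge_kap1 => //.
by rewrite (le_trans (KP _ z0 zx))// /L (le_trans (ler_norm K))// lerDr.
Qed.

(** On a small interval around [x] that avoids 0, a null [mu2] would make [f2], hence [f1], vanish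
    almost everywhere, so [mu1] would be null there too. *)
Lemma msupp_sub (mu1 mu2 : {measure set R -> \bar R}) (f1 f2 : R -> R) :
  density_on_Rstar mu1 f1 -> density_on_Rstar mu2 f2 ->
  (forall x, x != 0 -> {for x, continuous f1}) ->
  (forall x, x != 0 -> {for x, continuous f2}) ->
  (forall x, x != 0 -> 0 <= f2 x) ->
  (forall x, x != 0 -> f2 x = 0 -> f1 x = 0) ->
  msupp mu1 `&` Rstar R `<=` msupp mu2.
Proof.
move=> d1 d2 c1 c2 p2 z12 x [sx x0] e e0.
have x00 : 0 < `|x| by rewrite normr_gt0.
pose e' := Num.min e `|x|; have e0' : 0 < e' by rewrite lt_min e0.
pose B := `]x - e', x + e'[%classic : set R.
have mB : measurable B by exact: measurable_itv.
have B0 (y : R) : B y -> y != 0.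
  rewrite /B /= in_itv /= -ltr_distlC => h; apply/negP => /eqP y0.
  by move: h; rewrite y0 subr0 lt_min ltxx andbF.
have mf (f : R -> R) : (forall x, x != 0 -> {for x, continuous f}) -> measurable_fun B f.
  move=> cf; apply: open_continuous_measurable_fun; first exact: interval_open.
  by move=> y /set_mem /B0; exact: cf.
apply: (@lt_le_trans _ _ (mu2 B)); last first.
  rewrite le_measure// ?inE//; try exact: measurable_itv.
  apply: subset_itv; rewrite bnd_simp ?lerD2l ?lerN2; by rewrite ge_min lexx.
rewrite lt0e measure_ge0 andbT; apply/negP => /eqP mu20.
have := sx e' e0'; rewrite -/B => /gt_eqF/negP; apply; apply/eqP.
have mB1 : measurable_fun B (EFin \o f1) by apply/measurable_EFinP; exact: mf.
have mB2 : measurable_fun B (EFin \o f2) by apply/measurable_EFinP; exact: mf.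
have I0 : (\int[leb]_(y in B) `|(EFin \o f2) y| = 0)%E.
  rewrite -[RHS]mu20 d2//; apply: eq_integral => y /set_mem /B0 y0.
  by rewrite /= ger0_norm// p2.
have [/(_ I0) ae2 _] := @ae_eq_integral_abs _ _ _ leb B mB _ mB2.
have ae1 : ae_eq leb B (EFin \o f1) (cst 0%E).
  move: ae2; apply: filterS => y h By; have := h By => /= -[f20].
  by rewrite /= z12//; exact: B0.
rewrite d1// (ae_eq_integral (cst 0%E))// ?integral0//.
Qed.

Lemma stieltjes_boundary_density (mu : {measure set R -> \bar R}) (F : R[i] -> R[i])
    (Fb : R -> R[i]) :
  supported_Rplus mu -> (forall a b : R, (mu `[a, b] < +oo)%E) ->
  (\int[mu]_(t in Rplus R) ((1 + t)^-1)%:E < +oo)%E ->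
  (forall z, Cplus z -> F z = stieltjes mu z) ->
  (forall x, x != 0 -> lim_Cplus F x (Fb x)) ->
  [/\ forall x, x != 0 -> {for x, continuous (fun y => Im (Fb y))},
      forall x, x != 0 -> 0 <= Im (Fb x) &
      density_on_Rstar mu (fun x => Im (Fb x) / pi)].
Proof.
move=> mR mfin mint FS Flim.
have Slim x : x != 0 -> lim_Cplus (stieltjes mu) x (Fb x).
  by move=> x0; exact: lim_Cplus_ext FS (Flim x x0).
split.
- by move=> x; exact: boundary_Im_continuous Slim _.
- by move=> x; exact: boundary_Im_ge0 mint _ Slim _.
- exact: stieltjes_density.
Qed.

End BoundaryDensities.

Theorem theorem3p1 (R : realType) (c : R)
  (nu nut : probability R R)
  (delta deltat : R[i] -> R[i])
  (mu : probability R R)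
  (rho rhot : {measure set R -> \bar R}) :
  0 < c ->
  (* nu, nut : probability measures on R_+, different from the Dirac mass at 0 *)
  supported_Rplus nu -> supported_Rplus nut ->
  ~ (forall A : set R, measurable A -> nu A = \d_(0 : R) A) ->
  ~ (forall A : set R, measurable A -> nut A = \d_(0 : R) A) ->
  (* (delta, deltat) : the solution in C_+^2 of the system *)
  (forall z : R[i], Cplus z -> Cplus (delta z) /\ Cplus (deltat z)) ->
  (forall z : R[i], Cplus z ->
     delta z = c%:C * cint nu (fun t => t%:C / (- z * (1 + deltat z * t%:C)))) ->
  (forall z : R[i], Cplus z ->
     deltat z = cint nut (fun t => t%:C / (- z * (1 + delta z * t%:C)))) ->
  (* mu : the probability measure on R_+ with Stieltjes transform m *)
  supported_Rplus mu ->
  (forall z : R[i], Cplus z -> m_transform nu deltat z = stieltjes mu z) ->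
  (* rho, rhot : positive Radon measures on R_+ with Stieltjes transforms delta, deltat *)
  supported_Rplus rho -> supported_Rplus rhot ->
  (forall a b : R, (rho `[a, b] < +oo)%E) ->
  (forall a b : R, (rhot `[a, b] < +oo)%E) ->
  (0 < \int[rho]_(t in Rplus R) ((1 + t)^-1)%:E < +oo)%E ->
  (0 < \int[rhot]_(t in Rplus R) ((1 + t)^-1)%:E < +oo)%E ->
  (forall z : R[i], Cplus z -> delta z = stieltjes rho z) ->
  (forall z : R[i], Cplus z -> deltat z = stieltjes rhot z) ->
  boundary_density (m_transform nu deltat) mu /\
  boundary_density delta rho /\
  boundary_density deltat rhot /\
  msupp rho `&` Rstar R = msupp mu `&` Rstar R /\
  msupp rhot `&` Rstar R = msupp mu `&` Rstar R.
Proof.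
move=> c0 nuR nutR nu0 nut0 dC Ed Edt muR mE rhoR rhotR rhofin rhotfin
  /andP[_ rhoint] /andP[_ rhotint] rhoE rhotE.
have S : coupled_system c 1 nu nut delta deltat.
  split => //.
  - by move=> z /dC[].
  - by move=> z /dC[].
  - move=> z z0; have zn := Cplus_neq0 z0; have [_ dt0] := dC z z0.
    rewrite {1}(Ed z z0) mulrCA; congr (_ * _).
    rewrite (@eq_cint _ nu _ (fun t => (- z)^-1 * uker (deltat z) t)); last first.
      by move=> t _; rewrite /uker invfM mulrCA.
    rewrite cintZ; last exact: cbmeas_uker.
    by rewrite mulVKf// oppr_eq0.
  - move=> z z0; have zn := Cplus_neq0 z0; have [d0 _] := dC z z0.
    rewrite {1}(Edt z z0) mul1r.
    rewrite (@eq_cint _ nut _ (fun t => (- z)^-1 * uker (delta z) t)); last first.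
      by move=> t _; rewrite /uker invfM mulrCA.
    rewrite cintZ; last exact: cbmeas_uker.
    by rewrite mulVKf// oppr_eq0.
have S' := coupled_system_sym S.
(* The value at 0, where no limit is claimed, is an arbitrary default. *)
have /choice[Db DbP] (x : R) : exists D : R[i], x != 0 -> lim_Cplus delta x D.
  have [->|x0] := eqVneq x 0; first by exists 0.
  by have [D DP] := coupled_system_limit S x0; exists D.
have /choice[Dtb DtbP] (x : R) : exists D : R[i], x != 0 -> lim_Cplus deltat x D.
  have [->|x0] := eqVneq x 0; first by exists 0.
  by have [D DP] := coupled_system_limit S' x0; exists D.
pose Mb (x : R) : R[i] := - (x%:C)^-1 - Db x * Dtb x * c^-1%:C.
have MbP (x : R) : x != 0 -> lim_Cplus (m_transform nu deltat) x (Mb x).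
  by move=> x0; exact: m_transform_limit S x0 (DbP _ x0) (DtbP _ x0).
have muint : (\int[mu]_(t in Rplus R) ((1 + t)^-1)%:E < +oo)%E.
  apply: (@le_lt_trans _ _ (\int[mu]_(t in Rplus R) (cst 1%E) t)%E); last first.
    rewrite integral_cst ?mul1e; last exact: measurable_Rplus.
    by rewrite (le_lt_trans (probability_le1 _ _)) ?ltry//; exact: measurable_Rplus.
  apply: ge0_le_integral => //.
  - exact: measurable_Rplus.
  - by move=> t t0; rewrite lee_fin invr_ge0 addr_ge0.
  - by apply/measurable_EFinP; exact: measurable_inv1D.
  - by move=> t t0; rewrite lee_fin invf_le1 ?lerDl// ltr_pwDl.
have mufin (a b : R) : (mu `[a, b] < +oo)%E.
  by rewrite (le_lt_trans (probability_le1 _ _)) ?ltry.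
have [cm pm dm] := stieltjes_boundary_density muR mufin muint mE MbP.
have [cr pr dr] := stieltjes_boundary_density rhoR rhofin rhoint rhoE DbP.
have [crt prt drt] := stieltjes_boundary_density rhotR rhotfin rhotint rhotE DtbP.
have pi0 : 0 < pi :> R := pi_gt0 R.
have zD (x : R) : x != 0 -> complex.Im (Db x) = 0 -> complex.Im (Dtb x) = 0.
  move=> x0 D0; have [_ Dt0 [k k0]] := boundary_Im_bounds S x0 (DbP _ x0) (DtbP _ x0).
  by rewrite D0 mulr0 pmulr_rle0// => h; apply/eqP; rewrite eq_le h.
have zDt (x : R) : x != 0 -> complex.Im (Dtb x) = 0 -> complex.Im (Db x) = 0.
  move=> x0 D0; have [_ Dt0 [k k0]] := boundary_Im_bounds S' x0 (DtbP _ x0) (DbP _ x0).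
  by rewrite D0 mulr0 pmulr_rle0// => h; apply/eqP; rewrite eq_le h.
(* With [zD] and [zDt], this and its converse [zM'] make the three boundary imaginary parts vanish
   at the same nonzero points, which is all that [msupp_sub] asks. *)
have zM (x : R) : x != 0 -> complex.Im (Mb x) = 0 -> complex.Im (Dtb x) = 0.
  move=> x0 M0; have [k k0] := boundary_Im_m_bound S x0 (DtbP _ x0) (MbP _ x0).
  by rewrite M0 mulr0 pmulr_rle0// => h; apply/eqP; rewrite eq_le h prt.
have zM' (x : R) : x != 0 -> complex.Im (Dtb x) = 0 -> complex.Im (Mb x) = 0.
  move=> x0 Dt0; have D0 := zDt x x0 Dt0.
  by rewrite /Mb !partsE Dt0 D0 !(mul0r, mulr0, addr0, add0r, oppr0).
have divpi (f : R -> R[i]) (x : R) : (complex.Im (f x) / pi = 0) <-> (complex.Im (f x) = 0).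
  split=> [/eqP|->]; last by rewrite mul0r.
  by rewrite mulf_eq0 invr_eq0 (gt_eqF pi0) orbF => /eqP.
have cdiv (f : R -> R[i]) : (forall x : R, x != 0 -> {for x, continuous (fun y => complex.Im (f y))}) ->
    forall x : R, x != 0 -> {for x, continuous (fun y => complex.Im (f y) / pi)}.
  by move=> cf x /cf h; apply: cvgM => //; exact: cvg_cst.
have pdiv (f : R -> R[i]) : (forall x : R, x != 0 -> 0 <= complex.Im (f x)) ->
    forall x : R, x != 0 -> 0 <= complex.Im (f x) / pi.
  by move=> pf x /pf h; rewrite divr_ge0// ltW.
have subs (mu1 mu2 : {measure set R -> \bar R}) (f1 f2 : R -> R[i]) :
    density_on_Rstar mu1 (fun x => complex.Im (f1 x) / pi) ->
    density_on_Rstar mu2 (fun x => complex.Im (f2 x) / pi) ->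
    (forall x : R, x != 0 -> {for x, continuous (fun y => complex.Im (f1 y))}) ->
    (forall x : R, x != 0 -> {for x, continuous (fun y => complex.Im (f2 y))}) ->
    (forall x : R, x != 0 -> 0 <= complex.Im (f2 x)) ->
    (forall x : R, x != 0 -> complex.Im (f2 x) = 0 -> complex.Im (f1 x) = 0) ->
    msupp mu1 `&` Rstar R `<=` msupp mu2 `&` Rstar R.
  move=> d1 d2 c1 c2 p2 z12 x [sx x0]; split=> //.
  apply: (msupp_sub d1 d2 (cdiv _ c1) (cdiv _ c2) (pdiv _ p2)); last by split.
  by move=> y y0 /divpi/(z12 y y0)/divpi.
split; first by exists Mb.
split; first by exists Db.
split; first by exists Dtb.
split; apply/seteqP; split.
- by apply: (subs _ _ Db Mb) => // x x0 /(zM x x0)/(zDt x x0).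
- by apply: (subs _ _ Mb Db) => // x x0 /(zD x x0)/(zM' x x0).
- by apply: (subs _ _ Dtb Mb).
- by apply: (subs _ _ Mb Dtb).
Qed.
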